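(* Let $r,n\ge1$ and let $\mathsf{V}$ be a $(2r+1)$-orthogonal vacillating tableau of weight zero and length $n$. Then $$\mathsf{G}_V(\mathsf{V})=\mathsf{M}_{V\to O}(\mathsf{V})=\mathsf{M}_{V\to F}(\mathsf{V}).$$
   Context: Partitions with at most $r$ parts are identified with weakly decreasing $r$-tuples of nonnegative integers; $\emptyset=(0,\dots,0)$, $\mathbf{e}_i$ is the $i$-th unit vector, $\mathbf{1}=(1,\dots,1)$, $(\mu\cap\nu)_i=\min\{\mu_i,\nu_i\}$. For $x\in\mathbb{Z}^r$, $\mathrm{dom}(x)$ is obtained by sorting $|x_1|,\dots,|x_r|$ into weakly decreasing order. A $(2r+1)$-orthogonal vacillating tableau of length $n$ and weight zero is a sequence $\mathsf{V}=(\emptyset=\lambda^0,\dots,\lambda^n=\emptyset)$ of partitions with at most $r$ parts such that consecutive partitions are equal or differ by exactly one box, and if two consecutive partitions are equal then all their $r$ parts are positive. Embeddings. $\iota_{V\to O}(\mathsf{V})=(\mu^0,\dots,\mu^{2n})$ with $\mu^{2i}=2\lambda^i$, $\mu^{2i-1}=\lambda^{i-1}+\lambda^i$ if $\lambda^{i-1}\ne\lambda^i$, and $\mu^{2i-1}=\lambda^{i-1}+\lambda^i-\mathbf{e}_r$ if $\lambda^{i-1}=\lambda^i$. $\iota_{V\to F}(\mathsf{V})=(\mu^0,\dots,\mu^{2n})$ with $\mu^{2i}=2\lambda^i$ and $\mu^{2i-1}=2\lambda^{i-1}+\mathbf{1}$ if $\lambda^i=\lambda^{i-1}+\mathbf{e}_k$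 for some $k$, $\mu^{2i-1}=2\lambda^i+\mathbf{1}$ if $\lambda^{i-1}=\lambda^i+\mathbf{e}_k$ for some $k$, $\mu^{2i-1}=2\lambda^{i-1}+\mathbf{1}-2\mathbf{e}_r$ if $\lambda^{i-1}=\lambda^i$. Matrices $\mathsf{M}_{V\to X}(\mathsf{V})$, $X\in\{O,F\}$. One promotion step takes $(\mu^0,\dots,\mu^{2n})$ to $(\hat\mu^0,\dots,\hat\mu^{2n})$ as follows: put $a_2=\mu^1$, $a_c=\mathrm{dom}(a_{c-1}+\mu^c-\mu^{c-1})$ for $3\le c\le 2n$; $b_2=\emptyset$, $b_c=\mathrm{dom}(b_{c-1}+a_c-a_{c-1})$ for $3\le c\le 2n$; then $\hat\mu^{c-2}=b_c$ for $2\le c\le 2n$, $\hat\mu^{2n-1}=a_{2n}$, $\hat\mu^{2n}=\emptyset$. For $3\le c\le 2n$ the cell in row 1, column $c$ is filled with $\Phi_X(a_{c-1}+\mu^c-\mu^{c-1})$ and the cell in row 2, column $c$ with $\Phi_X(b_{c-1}+a_c-a_{c-1})$, where $\Phi_F(x)$ is the number of negative entries of $x$, and $\Phi_O(x)=1$ if $x$ has a negative entry and $0$ otherwise. Starting from $\iota_{V\to X}(\mathsf{V})$ perform $n$ promotion steps successively. $\mathsf{M}_{V\to X}(\mathsf{V})=(m_{i,j})_{1\le i,j\le n}$ has $m_{i,i}=0$, and for $1\le i\le n$, $2\le k\le n$ and $j\equiv i+k-1\pmod n$, $m_{i,j}$ is the sum of the four fillings of the cells in rows 1, 2 and columns $2k-1,2k$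 in the $i$-th promotion step. Matrix $\mathsf{G}_V(\mathsf{V})$. Consider lattice points $(x,y)$ with $x,y\ge0$, $x+y\le n$, and unit cells with north-east corner $(x,y)$, $x,y\ge1$, $x+y\le n$. For such a cell let $\alpha,\beta,\gamma,\delta$ be the partitions labelling its corners $(x-1,y)$, $(x,y)$, $(x-1,y-1)$, $(x,y-1)$, and $m$ its filling. Label $(x,n-x)$ by $2\lambda^x$ ($0\le x\le n$), and label $(x,n-1-x)$ ($0\le x\le n-1$) by $2(\lambda^x\cap\lambda^{x+1})$ if $\lambda^x\neq\lambda^{x+1}$ and by $2\lambda^x-\mathbf{e}_r$ if $\lambda^x=\lambda^{x+1}$. All other labels and all fillings are obtained by repeatedly applying the RSK backward rules, computing $\gamma$ and $m$ from $\alpha,\beta,\delta$: (B0) set $i:=\max\{j:\beta_j>0\}$, $\mathrm{CARRY}:=0$ (if $\beta=\emptyset$ then $\gamma=\emptyset$, $m=0$); (B1) set $\gamma_i:=\min\{\delta_i,\alpha_i\}-\mathrm{CARRY}$; (B2) set $\mathrm{CARRY}:=\beta_i-\max\{\delta_i,\alpha_i\}$ and $i:=i-1$; if $i=0$ stop and return $\gamma$ and $m=\mathrm{CARRY}$; otherwise go to (B1). $\mathsf{G}_V(\mathsf{V})$ is the symmetric $n\times n$ matrix with zero diagonal whose $(i,j)$ entry, $1\le j<i\le n$, is the filling of the cell with north-east corner $(j,n+1-i)$. *)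

(* Defs.v *)
From HB Require Import structures.
From mathcomp Require Import all_boot all_order all_algebra.

Set Implicit Arguments.
Unset Strict Implicit.
Unset Printing Implicit Defensive.

Import Order.TTheory GRing.Theory Num.Theory.
Local Open Scope ring_scope.

(* Entries of vectors and of matrices are numbered from 0 in Rocq and from 1
   in the mathematics.  Sequences of vectors are functions on nat, only the
   values at indices up to the length of the sequence being meaningful. *)

Section Vectors.
Variable r : nat.
Implicit Types x y : 'rV[int]_r.

Definition is_partition x : Prop :=
  (forall i : 'I_r, 0 <= x 0 i) /\
  (forall i j : 'I_r, (i <= j)%N -> x 0 j <= x 0 i).

(* e_r; the definition makes sense without assuming 0 < r. *)
Definition e_last : 'rV[int]_r := \row_(j < r) (j.+1 == r)%:R.

Definition meet x y : 'rV[int]_r := \row_(j < r) Num.min (x 0 j) (y 0 j).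

Definition dom x : 'rV[int]_r :=
  \row_(j < r)
    nth 0 (sort (fun a b : int => b <= a) [seq `|x 0 i| | i <- enum 'I_r]) j.

Definition add_box x y : bool := [exists k : 'I_r, y == x + delta_mx 0 k].

Definition Phi_F x : nat := #|[set j : 'I_r | x 0 j < 0]|.

Definition Phi_O x : nat := [exists j : 'I_r, x 0 j < 0].

End Vectors.

Definition vacillating_tableau r n (V : n.+1.-tuple 'rV[int]_r) : Prop :=
  let lam := nth 0 V in
  [/\ lam 0%N = 0, lam n = 0,
      forall i, (i <= n)%N -> is_partition (lam i)
    & forall i, (i < n)%N ->
        [\/ lam i.+1 = lam i /\ (forall j : 'I_r, 0 < lam i 0 j),
            add_box (lam i) (lam i.+1)
          | add_box (lam i.+1) (lam i)]].

Section Promotion.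
Variable r : nat.
Implicit Types lam mu : nat -> 'rV[int]_r.

(* For odd c = 2i - 1 one has c./2 = i - 1. *)
Definition iota_VO lam (c : nat) : 'rV[int]_r :=
  let i := c./2 in
  if ~~ odd c then lam i *+ 2
  else if lam i != lam i.+1 then lam i + lam i.+1
  else lam i + lam i.+1 - e_last r.

(* On a vacillating tableau the last case is lam i = lam i.+1. *)
Definition iota_VF lam (c : nat) : 'rV[int]_r :=
  let i := c./2 in
  if ~~ odd c then lam i *+ 2
  else if add_box (lam i) (lam i.+1) then lam i *+ 2 + const_mx 1
  else if add_box (lam i.+1) (lam i) then lam i.+1 *+ 2 + const_mx 1
  else lam i *+ 2 + const_mx 1 - e_last r *+ 2.

(* A row s_2, s_3, ... with s_2 = s and s_c = dom (s_(c-1) + mu c - mu (c-1))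
   for c >= 3; s_0 and s_1 are junk values. *)
Fixpoint prow (s : 'rV[int]_r) mu (c : nat) : 'rV[int]_r :=
  if c is c'.+1 then
    if (c <= 2)%N then s else dom (prow s mu c' + mu c - mu c')
  else s.

Definition prom_a mu : nat -> 'rV[int]_r := prow (mu 1%N) mu.
Definition prom_b mu : nat -> 'rV[int]_r := prow 0 (prom_a mu).

Definition promotion n mu (c : nat) : 'rV[int]_r :=
  if (c <= n.*2 - 2)%N then prom_b mu c.+2
  else if c == n.*2.-1 then prom_a mu n.*2
  else 0.

(* Sum of the fillings of the cells in rows 1 and 2 of column c >= 3. *)
Definition column_filling (Phi : 'rV[int]_r -> nat) mu (c : nat) : nat :=
  addn (Phi (prom_a mu c.-1 + mu c - mu c.-1))
       (Phi (prom_b mu c.-1 + prom_a mu c - prom_a mu c.-1)).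

(* For i != j the index k is the unique 2 <= k <= n with j = i + k - 1 mod n. *)
Definition promotion_matrix n (Phi : 'rV[int]_r -> nat) mu : 'M[int]_n :=
  \matrix_(i < n, j < n)
    if i == j then 0
    else let k := ((j + n - i) %% n).+1 in
         let mu_i := iter i (promotion n) mu in
         (column_filling Phi mu_i k.*2.-1 + column_filling Phi mu_i k.*2)%:Z.

End Promotion.

Definition M_VO r n (V : n.+1.-tuple 'rV[int]_r) : 'M[int]_n :=
  promotion_matrix n (@Phi_O r) (iota_VO (nth 0 V)).

Definition M_VF r n (V : n.+1.-tuple 'rV[int]_r) : 'M[int]_n :=
  promotion_matrix n (@Phi_F r) (iota_VF (nth 0 V)).

Section Growth.
Variable r : nat.
Implicit Types (alpha beta delta : 'rV[int]_r) (lam : nat -> 'rV[int]_r).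

(* Loop (B1)-(B2): processes the parts i, i - 1, ..., 1, where gamma contains
   the parts of the result after the i-th one. *)
Fixpoint rsk_loop alpha beta delta (i : nat) (carry : int) (gamma : seq int) :
    seq int * int :=
  if i is i'.+1 then
    let part (x : 'rV[int]_r) := nth 0 [seq x 0 j | j <- enum 'I_r] i' in
    rsk_loop alpha beta delta i'
      (part beta - Num.max (part delta) (part alpha))
      (Num.min (part delta) (part alpha) - carry :: gamma)
  else (gamma, carry).

(* The maximum is 0 if beta is empty; the result is then ([::], 0). *)
Definition rsk_backward alpha beta delta : seq int * int :=
  rsk_loop alpha beta delta (\max_(j < r | (0 < beta 0 j)%R) j.+1)%N 0 [::].

Definition rsk_gamma alpha beta delta : 'rV[int]_r :=
  \row_(j < r) nth 0 (rsk_backward alpha beta delta).1 j.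

Definition rsk_filling alpha beta delta : int :=
  (rsk_backward alpha beta delta).2.

(* growth_label lam d x is the label of the lattice point (x, n - d - x). For
   d >= 2 that point is the corner gamma of the cell with north-east corner
   (x + 1, n - d - x + 1). *)
Fixpoint growth_label lam (d x : nat) : 'rV[int]_r :=
  match d with
  | 0 => lam x *+ 2
  | d1.+1 =>
    match d1 with
    | 0 => if lam x != lam x.+1 then meet (lam x) (lam x.+1) *+ 2
           else lam x *+ 2 - e_last r
    | d2.+1 => rsk_gamma (growth_label lam d1 x) (growth_label lam d2 x.+1)
                         (growth_label lam d1 x.+1)
    end
  end.

(* Filling of the cell with north-east corner (x, y), x, y >= 1, x + y <= n. *)
Definition growth_filling n lam (x y : nat) : int :=
  let d := (n - (x + y))%N in
  rsk_filling (growth_label lam d.+1 x.-1) (growth_label lam d x)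
              (growth_label lam d.+1 x).

End Growth.

(* With i and j numbered from 0, the corner (j, n + 1 - i) is (j.+1, n - i). *)
Definition G_V r n (V : n.+1.-tuple 'rV[int]_r) : 'M[int]_n :=
  \matrix_(i < n, j < n)
    if (j < i)%N then growth_filling n (nth 0 V) j.+1 (n - i)
    else if (i < j)%N then growth_filling n (nth 0 V) i.+1 (n - j)
    else 0.

(* Main.v *)
(* For an oscillating tableau of weight zero, single boxes are added or removed,
   and its RSK growth diagram is filled by a perfect matching.  A row of the
   promotion diagram, computed with the local rule dom(b + c - a), is a sequence
   of jeu de taquin slides up to the partner p of the first letter, and the
   reverse process beyond p; the unique negative entry occurs at p.  Removing
   the first letter therefore leaves the growth diagram of the sequence which
   follows the promoted tableau before p and the original one from p on.
   The local rule is reversible, so the same holds for the promoted tableau and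
   its last letter, with the same intermediate sequence: promotion rotates the
   matching, and row i of the promotion matrix is row i of the growth diagram.

   Doubling a vacillating tableau gives such an oscillating tableau.  Since all
   strips are added from left to right, 2 x 2 blocks of Fomin cells compose to
   cells of the coarse RSK growth diagram, whence G_V = M_VO.  Finally, in both
   embeddings a 2 x 2 block of the local rule acts as one and the same rule on
   vacillating tableaux, with the same sum of fillings, whence M_VO = M_VF. *)
From HB Require Import structures.
From mathcomp Require Import all_boot all_order all_algebra perm zify.
From Stdlib Require Import FunctionalExtensionality.
Require Import Defs.

Set Implicit Arguments.
Unset Strict Implicit.
Unset Printing Implicit Defensive.

Import Order.TTheory GRing.Theory Num.Theory.
Local Open Scope ring_scope.

(** * Shapes and the local rules *)

(* Rows are numbered from 0; shapes of interest vanish beyond their last row. *)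
Notation shape := (nat -> int).
Implicit Types f g : shape.

(** No matching is ever constructed; all statements concern labels and fillings of cells. Deleting
    the first letter is a statement about a three-dimensional array with two layers, the diagrams
    before and after the deletion. Faces inside a layer are Fomin cells; faces joining the layers
    are slides in one direction and column bumps in the other. The column bumps must be carried
    along in the induction: without them a slide does not determine that the new face is again a
    Fomin cell with the old filling. The layers merge at the partner of the first letter, because
    the box that separates them there lies in the first column; its row is the one in which the
    local rule produces -1. The two rows of a promotion step are two rotations by one letter, so row
    [i] of the matrix belongs to the letters [2i] and [2i+1], numbered from 0. Consecutive vectors
    of [iota_VF] differ in every coordinate, so the single-box theory does not apply to it. The two
    embeddings share only the doubled vectors at even indices, which is why they are compared block
    by block. *)

Definition ispart f : Prop := forall k, 0 <= f k.+1 /\ f k.+1 <= f k.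
Definition box f (a : nat) : shape := fun k => f k + Posz (k == a).
Definition shape_min f g : shape := fun k => Num.min (f k) (g k).

Lemma eq_index f (i j : nat) : i = j -> f i = f j. Proof. by move->. Qed.

Lemma boxC f a b : box (box f a) b = box (box f b) a.
Proof. apply: functional_extensionality => k; rewrite /box; lia. Qed.

Lemma box_inj f a b : box f a = box f b -> a = b.
Proof. by move=> /(congr1 (fun h => h a)); rewrite /box; lia. Qed.

Lemma box_injl f g a : box f a = box g a -> f = g.
Proof.
move=> e; apply: functional_extensionality => k.
by move: (congr1 (fun h => h k) e); rewrite /box; lia.
Qed.

Lemma box_neq f a : box f a <> f.
Proof. by move=> /(congr1 (fun h => h a)); rewrite /box; lia. Qed.

Lemma box2_neq f a b : box (box f a) b <> f.
Proof. by move=> /(congr1 (fun h => h a)); rewrite /box; lia. Qed.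

Lemma ispart_ge0 f k : ispart f -> 0 <= f k.
Proof. move=> /(_ k); lia. Qed.

Lemma ispart_le f i j : ispart f -> (i <= j)%N -> f j <= f i.
Proof.
move=> pf; elim: j => [|j IH]; first by case: i.
rewrite leq_eqVlt => /orP[/eqP-> // | lij].
by have := IH lij; have := pf j; lia.
Qed.

(* Rules (B1)-(B2) in closed form: the carry into row k is
   beta k.+1 - max (delta k.+1) (alpha k.+1), which vanishes below beta. *)
Definition rsk_shape alpha beta delta : shape := fun k =>
  Num.min (alpha k) (delta k) + Num.max (alpha k.+1) (delta k.+1) - beta k.+1.
Definition rsk_cell (alpha beta delta : shape) : int :=
  beta 0%N - Num.max (alpha 0%N) (delta 0%N).

Lemma rsk_shapeC alpha beta delta : rsk_shape alpha beta delta = rsk_shape delta beta alpha.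
Proof. apply: functional_extensionality => k; rewrite /rsk_shape; lia. Qed.

Lemma rsk_cellC alpha beta delta : rsk_cell alpha beta delta = rsk_cell delta beta alpha.
Proof. rewrite /rsk_cell; lia. Qed.

Definition weak_cover f g : Prop := g = f \/ exists a, g = box f a.

(* The RSK rule when each edge adds at most one box. *)
Inductive fomin_cell (gamma alpha delta beta : shape) (m : int) : Prop :=
| FomId of alpha = gamma & delta = gamma & beta = gamma & m = 0
| FomA a of alpha = box gamma a & delta = gamma & beta = alpha & m = 0
| FomD b of alpha = gamma & delta = box gamma b & beta = delta & m = 0
| FomAD a b of a <> b & alpha = box gamma a & delta = box gamma b
    & beta = box alpha b & m = 0
| FomE a of alpha = box gamma a & delta = alpha & beta = box alpha a.+1 & m = 0
| Fom1 of alpha = gamma & delta = gamma & beta = box gamma 0 & m = 1.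

(** A Fomin cell is determined by its three other labels, so any array made of Fomin cells obeys the
    backward recursion. *)
Lemma fomin_cellE gamma alpha delta beta m :
  ispart gamma -> ispart beta ->
  fomin_cell gamma alpha delta beta m ->
  rsk_shape alpha beta delta = gamma /\ rsk_cell alpha beta delta = m.
Proof.
move=> pg pb fo; split; last first.
  case: fo => [-> -> -> ->|a -> -> -> ->|b -> -> -> ->|a b ab -> -> -> ->|a -> -> -> ->|-> -> -> ->];
  rewrite /rsk_cell /box; lia.
apply: functional_extensionality => k.
have := pg k; have := pb k.
case: fo => [-> -> -> _|a -> -> -> _|b -> -> -> _|a b ab -> -> -> _|a -> -> -> _|-> -> -> _];
  rewrite /rsk_shape /box; lia.
Qed.

Definition unbox f (a : nat) : shape := fun k => f k - Posz (k == a).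
Lemma unboxK f a : box (unbox f a) a = f.
Proof. apply: functional_extensionality => k; rewrite /box /unbox; lia. Qed.
Lemma fomin_cell_back alpha beta delta :
  ispart alpha -> ispart beta -> ispart delta -> weak_cover alpha beta -> weak_cover delta beta ->
  ispart (rsk_shape alpha beta delta) /\
  fomin_cell (rsk_shape alpha beta delta) alpha delta beta (rsk_cell alpha beta delta).
Proof.
move=> pa pb pd sa sd.
(* Any cell with these edges will do: [fomin_cellE] identifies it with the closed form. *)
suff [g [m [pg fo]]] : exists g m, ispart g /\ fomin_cell g alpha delta beta m.
  by have [-> ->] := fomin_cellE pg pb fo.
case: sa sd => [ea|[a ea]] [ed|[b e]].
- by exists alpha, 0; split=> //; apply: FomId; rewrite // -ed ea.
- exists delta, 0; split=> //; apply: (FomA (a := b)) => //; by rewrite -ea.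
- exists alpha, 0; split=> //; apply: (FomD (b := a)) => //; by rewrite -ed.
subst beta.
(* Equal rows force [alpha = delta]. A box in row 0 then comes from a filling 1, a box in row [a.+1]
   from a bump out of row [a]. *)
have [eab|nab] := eqVneq a b.
  move: e; rewrite eab => /box_injl e; subst b delta.
  case: a pb => [|a] pb; first by exists alpha, 1; split=> //; apply: Fom1.
  exists (unbox alpha a), 0; split; last by apply: (FomE (a := a)); rewrite ?unboxK.
  move=> k; have := @eq_index alpha k a; have := @eq_index alpha k.+1 a; have := @eq_index alpha k.+1 a.+1.
  have := pa k; have := pa a; have := pb a; rewrite /unbox /box; lia.
exists (unbox alpha b), 0; split.
  move=> k; have := pa k; have := pd k; have := pa k.+1; have := pd k.+1; have := pb k; have := pb k.+1.
  have ek := congr1 (fun h => h k) e; have ek1 := congr1 (fun h => h k.+1) e.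
  move: ek ek1; rewrite /unbox /box; lia.
have ed : delta = box (unbox alpha b) a.
  apply: functional_extensionality => k.
  have := congr1 (fun h => h k) e; rewrite /unbox /box; lia.
by apply: (FomAD (a := b) (b := a)) => //; rewrite ?unboxK //; lia.
Qed.

(* Piecewise-linear form of the jeu de taquin slide: the other shape between
   gamma and delta' (or the same one if they differ by a domino). *)
Definition slide (gamma gamma' delta' : shape) : shape := fun k =>
  (if k is k'.+1 then Num.min (gamma k') (delta' k) else delta' 0%N)
  + Num.max (gamma k) (delta' k.+1) - gamma' k.

(** The boxes [c], then [b], are exchanged unless they form a vertical domino; this is the only case
    in which [box f b] fails to be a partition. *)
Definition slide_idx (f : shape) (c b : nat) : nat :=
  if (b == c.+1) && (f c == f c.+1) then c else b.

Lemma slide_id gamma c : ispart gamma -> ispart (box gamma c) ->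
  slide gamma (box gamma c) (box gamma c) = gamma.
Proof.
move=> pg pg'; apply: functional_extensionality => k.
have := pg k; have := pg' k; rewrite /slide /box.
case: k => [|k]; first by lia.
by have := pg k; have := pg' k; rewrite /box; lia.
Qed.

Ltac subst_eq i j x :=
  let e := fresh "e" in
  (have [e|e] := eqVneq i j; [subst x|]).

(** The formula [slide] is the Bender-Knuth toggle of the middle shape: row [k] is reflected in the
    interval between [max (gamma k) (delta' k.+1)] and [min (gamma k.-1) (delta' k)]. *)
Lemma slide_box gamma c b : ispart gamma -> ispart (box gamma c) ->
  ispart (box (box gamma c) b) ->
  slide gamma (box gamma c) (box (box gamma c) b) = box gamma (slide_idx gamma c b).
Proof.
move=> pg pg' pd'; apply: functional_extensionality => k.
have h1 := pg k; have h2 := pg' k; have h3 := pd' k.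
have h4 := pg k.-1; have h5 := pg' k.-1; have h6 := pd' k.-1.
rewrite /slide /slide_idx; move: h2 h3 h5 h6; rewrite /box.
try subst_eq b c b; [|try subst_eq b c.+1 b]; case: k h1 h4 => [|k] /= h1 h4;
try case: ifP => h0.
all: try subst_eq k c k; try subst_eq 0%N c c; try subst_eq k.+1 c c; try subst_eq k c.+1 k; try lia.
Qed.

Lemma slide_idx_part gamma c b : ispart gamma -> ispart (box gamma c) ->
  ispart (box (box gamma c) b) -> ispart (box gamma (slide_idx gamma c b)).
Proof.
move=> pg pg' pd' k.
have h1 := pg k; have h2 := pg' k; have h3 := pd' k.
have h4 := pg k.+1; have h5 := pg' k.+1; have h6 := pd' k.+1.
rewrite /slide_idx; case: ifP => h0; move: h2 h3 h5 h6; rewrite /box.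
all: try subst_eq b c b; try subst_eq b c.+1 b.
all: try subst_eq k c k; try subst_eq k.+1 c c; try subst_eq k c.+1 k; try lia.
Qed.

(* Column bumping: if row a already holds the box at hand, that box goes to the
   first row j of the next column. *)
Definition colidx (f : shape) (c a j : nat) : Prop :=
  if a == c then (j <= a)%N /\ (j = a \/ f j = f a + 1) else j = a.

(** The column-insertion analogue of a Fomin cell, without a case that creates a box. The edge from
    [gamma] to [gamma'] joins the two layers. *)
Inductive col_face (gamma gamma' alpha alpha' : shape) : Prop :=
| ColFace0 c of gamma' = box gamma c & alpha = gamma & alpha' = gamma'
| ColFace1 c a j of gamma' = box gamma c & alpha = box gamma a
    & alpha' = box gamma' j & colidx gamma c a j.

Lemma slide_idx_comm f c b : exists d, box (box f c) b = box (box f (slide_idx f c b)) d /\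
   d = if slide_idx f c b == b then c else c.+1.
Proof.
exists (if slide_idx f c b == b then c else c.+1); split=> //.
rewrite /slide_idx; case: ifP => [/andP[/eqP-> _]|_]; last by rewrite eqxx boxC.
by rewrite (_ : (c == c.+1) = false) //; lia.
Qed.

(** Serves the case [FomAD] of [cube]. The right side is the row that the Fomin rule prescribes for
    the new [beta] over [alpha]: the slid box [slide_idx f c b], bumped to [a.+1] if it falls in row
    [a]. *)
Lemma slide_idx_union f a c j b : ispart f -> ispart (box f a) ->
  ispart (box (box f c) b) -> colidx f c a j -> j <> b ->
  slide_idx (box f a) (if a == c then j else c) b =
    if a == slide_idx f c b then a.+1 else slide_idx f c b.
Proof.
move=> pf pa pd; rewrite /colidx; have [eac|nac] := eqVneq a c; last first.
  move=> -> nab; rewrite /slide_idx /box; have [eb|nb] := eqVneq b c.+1; last first.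
    by rewrite /= ifN //; apply/eqP.
  subst b; have ca : (c == a) = false by lia.
  have ca' : (c.+1 == a) = false by lia.
  rewrite ca ca' !addr0 /=; case: ifP => _.
    by rewrite ifN.
  by rewrite ifN //; apply/eqP.
subst c; move=> [lja hj] njb.
have [eb|nb] := eqVneq b a.+1.
  subst b; rewrite {1}/slide_idx eqSS; transitivity a.+1.
    have [e|//] := eqVneq a j; rewrite -e ifF //= /box.
    by have := pf a; lia.
  rewrite /slide_idx eqxx /=; case: (f a == f a.+1); first by rewrite eqxx.
  by rewrite (_ : (a == a.+1) = false) //; lia.
have -> : slide_idx f a b = b by rewrite /slide_idx (negbTE nb).
have nab : a != b.
  apply/eqP => e; subst b; have ltj : (j < a)%N by lia.
  have := pd a.-1; have := ispart_le (i := j) (j := a.-1) pf.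
  by rewrite prednK /box; lia.
rewrite (negbTE nab) /slide_idx; case: ifP => // /andP[/eqP eb].
subst b; have := pd j; have := ispart_le (i := j.+1) (j := a) pf; rewrite /box.
have := pf j.
by case: hj => [ej|hj]; [subst j|]; lia.
Qed.

(** Companion of [slide_idx_union] for the opposite face: after the slide the layers differ by row
    [c] or [c.+1], and the column bump over the slid shape still ends in row [j]. *)
Lemma colidx_union f a c j b : ispart f -> ispart (box f a) -> ispart (box f c) ->
  ispart (box (box f c) b) -> colidx f c a j -> j <> b ->
  colidx (box f (slide_idx f c b)) (if slide_idx f c b == b then c else c.+1)
    (if a == slide_idx f c b then a.+1 else a) j.
Proof.
move=> pf pa pc pd; rewrite /colidx.
have S1 x : (x == x.+1) = false by lia.
have S2 x : (x.+1 == x) = false by lia.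
have [eac|nac] := eqVneq a c; last first.
  move=> ej njb; subst j; have eab : (a == b) = false by lia.
  have eac : (a == c) = false by lia.
  rewrite /slide_idx; case: (boolP (_ && _)) => [/andP[/eqP eb _]|_].
    by subst b; rewrite eac S1 eab.
  by rewrite eqxx eab eac.
subst c; move=> [lja hj] njb; rewrite /slide_idx.
have := pd j; have := ispart_le pf lja; have := ispart_le (i := j.+1) (j := a) pf.
have [eb|nb] := eqVneq b a.+1.
  subst b; rewrite /=; case: (eqVneq (f a) (f a.+1)) => h.
    rewrite S1 !eqxx => h1 h2 h3; split; first by lia.
    by right; have := @eq_index f j a; case: hj => hj; rewrite /box; lia.
  rewrite eqxx S1 eqxx => _ _ _; split=> //.
  by case: hj => [ej|hj]; [left|right; have := @eq_index f j a; rewrite /box; lia].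
rewrite /= eqxx; have [eb|nba] := eqVneq a b.
  subst b; move=> h1 h2 h3; exfalso.
  have ltj : (j < a)%N by lia.
  have := pd a.-1; have := ispart_le (i := j) (j := a.-1) pf.
  by rewrite prednK /box; lia.
rewrite eqxx /box => h1 h2 h3; split=> //.
by case: hj => [ej|hj]; [left|right; lia].
Qed.

(** Serves the case [FomA] or [FomE] in which [delta'] adds the same row [j] as [alpha']. A vertical
    domino would need [j = c.+1]: for [a = c] this contradicts [j <= a], otherwise [j = a] and
    [box f a] would not be a partition. *)
Lemma slide_idx_equal f a c j : ispart f -> ispart (box f a) -> ispart (box f c) ->
  ispart (box (box f c) j) -> colidx f c a j -> slide_idx f c j = j.
Proof.
move=> pf pa pc pd; rewrite /colidx /slide_idx; have [eac|nac] := eqVneq a c.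
  move=> [lja _]; subst c; have -> : (j == a.+1) = false by lia.
  by [].
move=> ej; subst j; case: ifP => // /andP[/eqP e /eqP]; subst a.
by have := pa c; rewrite /box; lia.
Qed.

Lemma slide_idx_equal2 f a c j : ispart f -> ispart (box f a) -> ispart (box f c) ->
  ispart (box (box f c) j) -> colidx f c a j ->
  slide_idx (box f a) (if a == c then j else c) j.+1 = if a == j then a.+1 else j.
Proof.
move=> pf pa pc pd; rewrite /colidx /slide_idx; have [eac|nac] := eqVneq a c; last first.
  move=> ej; subst j; rewrite eqxx; case: ifP => // /andP[/eqP e].
  by lia.
move=> [lja hj]; subst c; rewrite eqxx /=.
have [eaj|naj] := eqVneq a j.
  by subst j; rewrite ifF // /box; have := pf a; lia.
have {}hj : f j = f a + 1 by case: hj => // e; lia.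
rewrite ifT //; apply/eqP; rewrite /box.
have [e|ne] := eqVneq a j.+1; first by subst a; lia.
have := pa a.-1; have := ispart_le (i := j.+1) (j := a.-1) pf; have := pf j.
by rewrite prednK /box; lia.
Qed.

Lemma colidx_equal f a c j : ispart f -> ispart (box f a) -> ispart (box f c) ->
  ispart (box (box f c) j) -> colidx f c a j ->
  colidx (box f j) c (if a == j then a.+1 else a) j.+1.
Proof.
move=> pf pa pc pd; rewrite /colidx; have [eac|nac] := eqVneq a c; last first.
  move=> ej; subst j; rewrite eqxx; case: ifP => // /eqP e; subst c.
  by split=> //; left.
move=> [lja hj]; subst c.
have [eaj|naj] := eqVneq a j.
  by subst j; have -> : (a.+1 == a) = false by lia.
rewrite eqxx; split; first by lia.
have [e|ne] := eqVneq a j.+1; first by left.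
have {}hj : f j = f a + 1 by case: hj => // e; lia.
right; rewrite /box; have := pf j; have := pa a.-1; have := ispart_le (i := j.+1) (j := a.-1) pf.
by rewrite prednK /box; lia.
Qed.

(* The faces of the cube are Fomin cells, slides and column bumps, in the three
   directions: this propagates the deletion of the first letter. *)
Lemma cube gamma gamma' alpha alpha' delta' beta' m :
  ispart gamma -> ispart gamma' -> ispart alpha -> ispart alpha' ->
  ispart delta' -> ispart beta' ->
  col_face gamma gamma' alpha alpha' -> fomin_cell gamma' alpha' delta' beta' m ->
  let delta := slide gamma gamma' delta' in
  let beta := slide alpha alpha' beta' in
  [/\ ispart delta, ispart beta, fomin_cell gamma alpha delta beta m
    & col_face delta delta' beta beta'].
Proof.
move=> pg pg' pa pa' pd' pb' [c|c a j] eg' ea ea'.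
  subst gamma' alpha alpha'.
  case=> [_ ed eb ->|a ea|b _ ed eb ->|a b _ ea|a ea|_ ed eb ->];
    try (by case: (box_neq (esym ea))).
  - subst delta' beta'; rewrite /= slide_id //; split=> //; first exact: FomId.
    exact: (ColFace0 (c := c)).
  - subst delta' beta'; rewrite /= slide_box //.
    have pb := slide_idx_part pg pg' pd'.
    split=> //; first exact: (FomD (b := slide_idx gamma c b)).
    by have [d [e _]] := slide_idx_comm gamma c b; apply: (ColFace0 (c := d)).
  (* A cell filled with 1 is where a nontrivial column face is born: the new box lies in row 0 of
     both layers. *)
  - subst delta' beta'; rewrite /= slide_id // slide_box //.
    have pb := slide_idx_part pg pg' pb'.
    have e0 : slide_idx gamma c 0 = 0%N by rewrite /slide_idx.
    split=> //; rewrite e0; first exact: Fom1.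
    apply: (ColFace1 (c := c) (a := 0) (j := 0)) => //.
    by rewrite /colidx; case: ifP => // _; split=> //; left.
subst gamma' alpha alpha' => cj.
(* The row of the box by which the layers differ at [alpha]. *)
pose c2 := if a == c then j else c.
have ea' : box (box gamma c) j = box (box gamma a) c2.
  rewrite /c2; move: cj; rewrite /colidx; case: eqP => [->//|_ ->].
  by rewrite boxC.
have H1 := @eq_index gamma j a. have H2 := @eq_index gamma c a.
case=> [e|a' e ed eb ->|b e|a' b ab e ed eb ->|a' e ed eb ->|e];
    try (by case: (box_neq e)).
- subst delta' beta'; rewrite /= slide_id // ea' slide_id -?ea' //.
  split=> //; first exact: (FomA (a := a)).
  exact: (ColFace1 (c := c) (a := a) (j := j)).
- have ej := box_inj e; subst a' delta' beta'; rewrite /= slide_box //.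
  move: pb' pa'; rewrite ea' => pb' pa'; rewrite slide_box //.
  have pb := slide_idx_part pg pg' pd'; have pb2 := slide_idx_part pa pa' pb'.
  set s := slide_idx gamma c b in pb *; set t := slide_idx (box gamma a) c2 b in pb2 *.
  have et : t = if a == s then a.+1 else s.
    exact: slide_idx_union pg pa pd' cj ab.
  have cu := colidx_union pg pa pg' pd' cj ab; rewrite -/s in cu.
  have [d [ed' ed]] := slide_idx_comm gamma c b; rewrite -/s -ed in cu ed'.
  split=> //.
    rewrite et; case: eqP => [<-|nas]; first exact: (FomE (a := a)).
    exact: (FomAD (a := a) (b := s)).
  apply: (ColFace1 _ _ _ cu) => //; last by rewrite -ea' boxC.
  by rewrite et; case: eqP => [<-|nas] //; rewrite boxC.
- have ej := box_inj e; subst a' delta' beta'; rewrite /= slide_box //.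
  move: pb' pa'; rewrite ea' => pb' pa'; rewrite slide_box //.
  rewrite (slide_idx_equal pg pa pg' pd' cj).
  have pb2 := slide_idx_part pa pa' pb'.
  move: pb2; rewrite (slide_idx_equal2 pg pa pg' pd' cj) => pb2.
  have pb : ispart (box gamma j) by have := slide_idx_part pg pg' pd'; rewrite (slide_idx_equal pg pa pg' pd' cj).
  split=> //.
    case: eqP => [<-|naj]; first exact: (FomE (a := a)).
    exact: (FomAD (a := a) (b := j)).
  apply: (ColFace1 _ _ _ (colidx_equal pg pa pg' pd' cj)); rewrite -?ea' 1?boxC //.
  by case: eqP => [<-|naj] //; rewrite boxC.
Qed.

(** * Growth arrays *)

(** Since row [c] of [gamma] is empty, the extra box lies in the first column. If it is bumped, it
    goes to the next row, also empty; the two boxes then form a vertical domino and the slide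
    returns [delta] all the same. *)
Lemma cube_first gamma c delta beta m :
  ispart gamma -> ispart (box gamma c) -> ispart delta -> ispart beta ->
  gamma c = 0 -> fomin_cell gamma (box gamma c) delta beta m ->
  [/\ slide gamma (box gamma c) beta = delta, m = 0
    & exists c', beta = box delta c' /\ delta c' = 0].
Proof.
move=> pg pa pd pb g0 [e|a e ed eb ->|b e|a b ab e ed eb ->|a e ed eb ->|e];
  try (by case: (box_neq e)).
- by subst delta beta; rewrite slide_id //; split=> //; exists c.
- have ec := box_inj e; subst a delta beta; rewrite slide_box //.
  have e1 : slide_idx gamma c b = b.
    rewrite /slide_idx; case: ifP => // /andP[/eqP eb _]; subst b.
    by have := pd c; have := pg c; rewrite /box; lia.
  rewrite e1; split=> //; exists c; split; first by rewrite boxC.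
  by rewrite /box g0; lia.
- have ec := box_inj e; subst a delta beta; rewrite slide_box //.
  have g1 : gamma c.+1 = 0 by have := pg c; have := pg c.+1; lia.
  have e1 : slide_idx gamma c c.+1 = c by rewrite /slide_idx g0 g1 !eqxx.
  by rewrite e1; split=> //; exists c.+1; split=> //; rewrite /box g1; lia.
Qed.

Lemma slide_ok gamma gamma' delta' c : ispart gamma -> ispart gamma' -> ispart delta' ->
  gamma' = box gamma c -> weak_cover gamma' delta' ->
  ispart (slide gamma gamma' delta') /\
  exists c', delta' = box (slide gamma gamma' delta') c'.
Proof.
move=> pg pg' pd' eg [ed|[b ed]]; subst gamma' delta'.
  by rewrite slide_id //; split=> //; exists c.
rewrite slide_box //; split; first exact: slide_idx_part.
by have [d [e _]] := slide_idx_comm gamma c b; exists d.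
Qed.

Definition adjacent f g : Prop := (exists a, g = box f a) \/ (exists a, f = box g a).
Definition shape0 : shape := fun=> 0.

Lemma fomin_cell_cover gamma alpha delta beta m : fomin_cell gamma alpha delta beta m ->
  weak_cover gamma alpha /\ weak_cover gamma delta.
Proof.
case=> [->->|a->->|b->->|a b _ ->->|a->->|->->] _ _; split; try (by left); right;
  by [exists a|exists b].
Qed.

Lemma shape_min_l f g : (forall k, f k <= g k) -> shape_min f g = f.
Proof. move=> h; apply: functional_extensionality => k; have := h k; rewrite /shape_min; lia. Qed.
Lemma shape_minC f g : shape_min f g = shape_min g f.
Proof. apply: functional_extensionality => k; rewrite /shape_min; lia. Qed.

Lemma weak_cover_le f g k : weak_cover f g -> f k <= g k.
Proof. by case=> [->|[a ->]]; rewrite /box; lia. Qed.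

Lemma adjacent_min f g : ispart f -> ispart g -> adjacent f g ->
  [/\ ispart (shape_min f g), weak_cover (shape_min f g) f & weak_cover (shape_min f g) g].
Proof.
have H a b c : ispart a -> b = box a c -> [/\ ispart (shape_min a b), weak_cover (shape_min a b) a & weak_cover (shape_min a b) b].
  move=> pa eb.
  have em : shape_min a b = a by apply: shape_min_l => k; rewrite eb /box; lia.
  by rewrite em; split=> //; [left|right; exists c].
move=> pf pg [[a e]|[a e]]; first exact: (H f g a).
by rewrite shape_minC; have [? ? ?] := H g f a pg e; split.
Qed.

Fixpoint grow (h : nat -> shape) (d x : nat) : shape :=
  match d with
  | 0 => h x
  | d1.+1 =>
    match d1 with
    | 0 => shape_min (h x) (h x.+1)
    | d2.+1 => rsk_shape (grow h d1 x) (grow h d2 x.+1) (grow h d1 x.+1)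
    end
  end.

(* For x <= z <= N, the label of the lattice point (x, N - z); points of the
   hypotenuse are labelled by h. *)
Definition label h x z := grow h (z - x) x.
Arguments label : simpl never.
(* The filling of the cell of the letters x < z, numbered from 0. *)
Definition growth_fill h x z := rsk_cell (label h x z) (label h x.+1 z) (label h x.+1 z.+1).

Lemma label_diag h x : label h x x = h x.
Proof. by rewrite /label subnn. Qed.
Lemma label_offdiag h x : label h x x.+1 = shape_min (h x) (h x.+1).
Proof. by rewrite /label subSnn. Qed.
Lemma label_rec h x z : (x < z)%N ->
  label h x z.+1 = rsk_shape (label h x z) (label h x.+1 z) (label h x.+1 z.+1).
Proof.
move=> lxz; rewrite /label.
have -> : (z.+1 - x = (z - x.+1).+2)%N by lia.
have -> : (z - x = (z - x.+1).+1)%N by lia.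
by have -> : (z.+1 - x.+1 = (z - x.+1).+1)%N by lia.
Qed.

(** Labels are recognised by the backward recursion and the first two diagonals. The bounds [a], [b]
    allow arrays that begin at 1, as after a deletion. *)
Lemma label_unique (A : nat -> nat -> shape) h a b :
  (forall x, (a <= x <= b)%N -> A x x = h x) ->
  (forall x, (a <= x < b)%N -> A x x.+1 = shape_min (h x) (h x.+1)) ->
  (forall x z, (a <= x)%N -> (x < z < b)%N ->
    A x z.+1 = rsk_shape (A x z) (A x.+1 z) (A x.+1 z.+1)) ->
  forall x z, (a <= x)%N -> (x <= z <= b)%N -> A x z = label h x z.
Proof.
move=> H0 H1 H2 x z; have [d] := ubnP (z - x); elim: d x z => // d IH x z ld lax lxz.
have [e|n] := eqVneq z x; first by subst z; rewrite label_diag H0 //; lia.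
have [e|n2] := eqVneq z x.+1; first by subst z; rewrite label_offdiag H1 //; lia.
case: z ld lxz n n2 => [|z] ld lxz n n2; first by lia.
rewrite label_rec; last by lia.
rewrite H2; [|lia|lia].
by rewrite (IH x z) ?(IH x.+1 z) ?(IH x.+1 z.+1); first reflexivity; lia.
Qed.

Definition oscillating N (h : nat -> shape) : Prop :=
  [/\ h 0%N = shape0, h N = shape0, forall x, (x <= N)%N -> ispart (h x)
    & forall x, (x < N)%N -> adjacent (h x) (h x.+1)].

Section Osc.
Variables (N : nat) (h : nat -> shape).
Hypothesis oh : oscillating N h.

(** Shapes and edges are treated in one induction because the backward rule gives a partition only
    when its two upper edges add at most one box. *)
Lemma label_part_cover x z : (x <= z <= N)%N ->
  ispart (label h x z) /\
  ((x < z)%N -> weak_cover (label h x z) (label h x.+1 z) /\ weak_cover (label h x z) (label h x z.-1)).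
Proof.
have [_ _ ph sh] := oh.
have [d] := ubnP (z - x); elim: d x z => // d IH x z ld lxz.
have [e|n] := eqVneq z x.
  by subst z; rewrite label_diag; split; [apply: ph|]; lia.
have [e|n2] := eqVneq z x.+1.
  subst z; rewrite label_offdiag /= !label_diag.
  by have [|||p1 p2 p3] := @adjacent_min (h x) (h x.+1); [apply: ph; lia|apply: ph; lia|apply: sh; lia|].
case: z ld lxz n n2 => [|z] ld lxz n n2; first by lia.
have [||pa sa] := IH x z; [lia|lia|].
have [||pb _] := IH x.+1 z; [lia|lia|].
have [||pd sd] := IH x.+1 z.+1; [lia|lia|].
have [|sa1 _] := sa; first by lia.
have [|_ sd1] := sd; first by lia.
rewrite label_rec; last by lia.
have [pg fo] := fomin_cell_back pa pb pd sa1 sd1.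
by have [? ?] := fomin_cell_cover fo.
Qed.

Lemma label_part x z : (x <= z <= N)%N -> ispart (label h x z).
Proof. by move=> /label_part_cover[]. Qed.

Lemma label_fomin x z : (x < z < N)%N ->
  fomin_cell (label h x z.+1) (label h x z) (label h x.+1 z.+1) (label h x.+1 z) (growth_fill h x z).
Proof.
move=> l; rewrite label_rec ?/growth_fill; last by lia.
apply: (fomin_cell_back _ _ _ _ _).2; try (apply: label_part; lia).
  by have [|_ [|? _]] := @label_part_cover x z; [lia|lia|].
by have [|_ [|_ ?]] := @label_part_cover x.+1 z.+1; [lia|lia|].
Qed.

Lemma label_cover_x x z : (x < z <= N)%N -> weak_cover (label h x z) (label h x.+1 z).
Proof. by move=> l; have [|_ [|? _]] := @label_part_cover x z; [lia|lia|]. Qed.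
Lemma label_cover_z x z : (x <= z < N)%N -> weak_cover (label h x z.+1) (label h x z).
Proof. by move=> l; have [|_ [|_ ?]] := @label_part_cover x z.+1; [lia|lia|]. Qed.

Lemma weak_cover_shape0 f : ispart f -> weak_cover f shape0 -> f = shape0.
Proof.
move=> pf s; apply: functional_extensionality => k.
by have := weak_cover_le k s; have := pf k; rewrite /shape0; lia.
Qed.

Lemma label_first z : (z <= N)%N -> label h 0 z = shape0.
Proof.
have [h0 _ _ _] := oh.
elim: z => [|z IH] lz; first by rewrite label_diag.
apply: weak_cover_shape0; first by apply: label_part; lia.
by rewrite -IH; [apply: label_cover_z|]; lia.
Qed.

Lemma label_last x : (x <= N)%N -> label h x N = shape0.
Proof.
have [_ hN _ _] := oh.
move=> lx; have [d] := ubnP (N - x); elim: d x lx => // d IH x lx ld.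
have [->|n] := eqVneq x N; first by rewrite label_diag.
apply: weak_cover_shape0; first by apply: label_part; lia.
by rewrite -(IH x.+1); [apply: label_cover_x| |]; lia.
Qed.

Lemma label_second z : (0 < z <= N)%N -> label h 1 z = shape0 \/ label h 1 z = box shape0 0.
Proof.
move=> lz; have := @label_cover_x 0 z; rewrite label_first; last by lia.
case=> [|->|[a e]]; [by lia|by left|right].
have := @label_part 1 z lz; rewrite e => p.
by case: a e p => [//|a] e p; have := p a; rewrite /box /shape0; lia.
Qed.

End Osc.

(** * Jeu de taquin on a whole growth diagram *)

(** * Deleting the first element *)

(** Jeu de taquin applied to the chain [R 1], [R 2], ..., with the box of [R 1] removed; the value
    at 0 is a dummy. *)
Fixpoint slide_row (R : nat -> shape) (x : nat) : shape :=
  if x is x'.+1 then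
    if x' is 0 then shape0 else slide (slide_row R x') (R x') (R x)
  else shape0.

(* f is g with rows a and j exchanged, so sorting f gives g. *)
Definition swapped f g : Prop := exists a j,
  (forall k, f k = g k + Posz (k == a) - Posz (k == j)) /\ (a = j \/ g j = g a + 1).

Lemma ispart_shape0 : ispart shape0.
Proof. by move=> k; rewrite /shape0. Qed.

Section Deletion.
Variables (N : nat) (h : nat -> shape).
Hypothesis oh : oscillating N h.
Hypothesis N0 : (0 < N)%N.
Local Notation L := (label h).

(* p is the partner of the first letter, numbered from 1. *)
Lemma exists_first : exists p, [/\ (1 < p <= N)%N,
  forall z, (0 < z < p)%N -> L 1 z = box shape0 0 &
  forall z, (p <= z <= N)%N -> L 1 z = shape0].
Proof.
have [h0 hN ph sh] := oh.
pose P z := (0 < z)%N && (L 1 z 0%N == 0).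
(* The labels [L 1 z] have at most one box and shrink as [z] grows, so they become empty once and
   for all at the least such [z]. *)
have exP : exists z, P z by exists N; rewrite /P N0 /= (label_last oh) //.
have pP := ex_minnP exP; case: pP => p /andP[p0 /eqP Lp] minp.
have hp z : (0 < z < p)%N -> (z <= N)%N -> L 1 z = box shape0 0.
  move=> lz lzN; have [|e|//] := label_second oh (z := z); first by lia.
  by have := minp z; rewrite /P e /shape0; lia.
have lpN : (p <= N)%N by apply: minp; rewrite /P N0 (label_last oh).
exists p; split.
- have [e1|n1] := eqVneq p 1%N; last by lia.
  move: Lp; rewrite e1 label_diag; have := sh 0%N N0; rewrite h0 => -[[a e]|[a e]].
    have := ph 1%N N0; rewrite e => pa.
    by case: a e pa => [|a] e pa; rewrite /box /shape0 //; have := pa a; rewrite /box /shape0; lia.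
  by have := ph 1%N N0 a; move: (congr1 (fun f => f a) e); rewrite /box /shape0; lia.
- by move=> z lz; apply: hp; lia.
- move=> z; elim: z => [|z IH] lz; first by lia.
  have [e|n] := eqVneq p z.+1.
    have [|//|e2] := label_second oh (z := z.+1); first by lia.
    by move: Lp; rewrite e e2 /box /shape0.
  apply: (weak_cover_shape0 (label_part oh _)); first by lia.
  by rewrite -IH; [apply: (label_cover_z oh)|]; lia.
Qed.

Variable p : nat.
Hypothesis lp : (1 < p <= N)%N.
Hypothesis L1 : forall z, (0 < z < p)%N -> L 1 z = box shape0 0.
Hypothesis L0 : forall z, (p <= z <= N)%N -> L 1 z = shape0.

(* The labels after removing the first letter, that is, the first column; rows
   from p on do not meet it. *)
Definition del_label x z := if (z < p)%N then slide_row (L^~ z) x else L x z.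
Local Notation K := del_label.

Lemma del_label1 z : (z < p)%N -> K 1 z = shape0.
Proof. by rewrite /del_label => ->. Qed.

Lemma del_labelS x z : (z < p)%N -> (0 < x)%N -> K x.+1 z = slide (K x z) (L x z) (L x.+1 z).
Proof. by rewrite /del_label => -> /=; case: x. Qed.

Lemma del_label_ge x z : (p <= z)%N -> K x z = L x z.
Proof. by rewrite /del_label; case: ltnP => //; lia. Qed.

(** Induction on [x], starting from the empty shape below a single box. The column face between the
    rows [z.+1] and [z] is the part of the invariant that [cube] consumes and reproduces. *)
Lemma del_label_low x z : (0 < x <= z)%N -> (z < p)%N ->
  [/\ ispart (K x z), exists c, L x z = box (K x z) c &
   (z.+1 < p)%N -> col_face (K x z.+1) (L x z.+1) (K x z) (L x z)].
Proof.
elim: x z => [|x IH] z lx lz; first by lia.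
have [ex|nx] := eqVneq x 0%N.
  subst x; rewrite del_label1 // L1; last by lia.
  split=> [||lz1]; [exact: ispart_shape0|by exists 0%N|].
  by rewrite del_label1 // (L1 (z := z.+1)); [apply: (ColFace0 (c := 0))|lia].
have [||pK [c eL] colK] := IH z; try lia.
rewrite del_labelS //; last by lia.
have pL := @label_part _ _ oh.
have [|||pS [c' eS]] := @slide_ok (K x z) (L x z) (L x.+1 z) c pK _ _ eL;
  [apply: pL; lia|apply: pL; lia|apply: (label_cover_x oh); lia|].
split=> //; first by exists c'.
move=> lz1; have [||pK1 _ _] := IH z.+1; try lia.
rewrite del_labelS; try lia.
by have [|||||_ _ _ //] := cube pK1 _ pK _ _ _ (colK lz1) (label_fomin oh (x := x) (z := z) _);
  [apply: pL; lia|apply: pL; lia|apply: pL; lia|apply: pL; lia|lia].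
Qed.

Lemma del_fomin_low x z : (0 < x < z)%N -> (z.+1 < p)%N ->
  fomin_cell (K x z.+1) (K x z) (K x.+1 z.+1) (K x.+1 z) (growth_fill h x z).
Proof.
move=> lx lz.
have [||pK _ colK] := @del_label_low x z; try lia.
have [||pK1 _ _] := @del_label_low x z.+1; try lia.
have pL := @label_part _ _ oh.
rewrite !del_labelS; try lia.
by have [|||||_ _ //] := cube pK1 _ pK _ _ _ (colK lz) (label_fomin oh (x := x) (z := z) _);
  [apply: pL; lia|apply: pL; lia|apply: pL; lia|apply: pL; lia|lia].
Qed.

(** The slid row just before the partner equals the old row at the partner, so the two halves of
    [del_label] fit together. The emptiness of row [c] is what [cube_first] needs for the next
    [x]. *)
Lemma del_label_first x : (0 < x < p)%N ->
  K x p.-1 = L x p /\ exists c, L x p.-1 = box (L x p) c /\ L x p c = 0.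
Proof.
elim: x => [|x IH] lx; first by lia.
have [ex|nx] := eqVneq x 0%N.
  subst x; rewrite del_label1 ?(L1 (z := p.-1)) ?(L0 (z := p)); try lia.
  by split=> //; exists 0%N.
have [|eK [c [eL L0c]]] := IH; first by lia.
have pL := @label_part _ _ oh.
rewrite del_labelS; try lia.
rewrite eK eL.
have := label_fomin oh (x := x) (z := p.-1).
have -> : p.-1.+1 = p by lia.
rewrite eL => fo.
have [|||||] := cube_first _ _ _ _ L0c (fo _); rewrite -?eL; try (apply: pL; lia); first by lia.
by move=> -> _ ?.
Qed.

(** The new cells at the seam have two equal rows and hence filling 0; the old ones have filling 0
    by [cube_first]. *)
Lemma del_fomin_first x : (0 < x < p.-1)%N ->
  fomin_cell (K x p) (K x p.-1) (K x.+1 p) (K x.+1 p.-1) (growth_fill h x p.-1).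
Proof.
move=> lx; have pL := @label_part _ _ oh.
have [|e1 [c [eL L0c]]] := @del_label_first x; first by lia.
have [|e2 _] := @del_label_first x.+1; first by lia.
rewrite e1 e2 !del_label_ge //.
have := label_fomin oh (x := x) (z := p.-1).
have -> : p.-1.+1 = p by lia.
rewrite eL => fo.
have [|||||] := cube_first _ _ _ _ L0c (fo _); rewrite -?eL; try (apply: pL; lia); first by lia.
move=> _ -> _.
have [|e|[b e]] := label_cover_x oh (x := x) (z := p); first by lia.
  by apply: FomId.
by apply: (FomD (b := b)).
Qed.

Lemma del_fomin x z : (0 < x < z)%N -> (z < N)%N ->
  fomin_cell (K x z.+1) (K x z) (K x.+1 z.+1) (K x.+1 z) (growth_fill h x z).
Proof.
move=> lx lz; case: (ltngtP z.+1 p) => hz.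
- exact: del_fomin_low.
- by rewrite !del_label_ge; try lia; apply: (label_fomin oh); lia.
- have -> : z = p.-1 by lia.
  by have -> : p.-1.+1 = p by [lia]; apply: del_fomin_first; lia.
Qed.

Lemma del_label_part x z : (0 < x <= z)%N -> (z <= N)%N -> ispart (K x z).
Proof.
move=> lx lz; case: (ltnP z p) => hz; first by have [] := @del_label_low x z lx hz.
by rewrite del_label_ge //; apply: (label_part oh); lia.
Qed.

Definition del_diag x := K x x.

(** This is where the growth diagram meets the local rule: the exchange undone by sorting is a slide
    over an up step and a column bump over a down step. *)
Lemma del_diag_step x : (0 < x)%N -> (x.+1 < p)%N ->
  K x x.+1 = shape_min (del_diag x) (del_diag x.+1) /\
  swapped (fun k => del_diag x k + h x.+1 k - h x k) (del_diag x.+1).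
Proof.
move=> x0 lx; have [_ _ ph sh] := oh.
have [||pK [c eL] co] := @del_label_low x x; [lia|lia|].
have {}co := co lx.
have [||pK1 [c1 eL1] _] := @del_label_low x x.+1; [lia|lia|].
have eK2 := @del_labelS x x.+1 lx x0; rewrite /del_diag eK2.
have px : ispart (h x) by apply: ph; lia.
have px1 : ispart (h x.+1) by apply: ph; lia.
rewrite label_diag; rewrite label_diag in eL; rewrite label_offdiag in eL1; rewrite label_diag label_offdiag in co; rewrite label_offdiag.
have [|[b e]|[b e]] := sh x; first by lia.
  have em : shape_min (h x) (h x.+1) = h x by apply: shape_min_l => k; rewrite e /box; lia.
  rewrite em e; rewrite em in eL1 co.
  case: co => [c2 e2 e3 _|c2 a j _ _ e2]; last by case: (box_neq (esym e2)).
  rewrite -e3 eL slide_box; [|done|by rewrite -eL|by rewrite -eL -e]; split.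
    by rewrite shape_min_l // => k; rewrite /box; lia.
  exists b, (slide_idx (K x x) c b); split; first by move=> k; rewrite /box; lia.
  rewrite /slide_idx; case: ifP => [/andP[/eqP-> /eqP e4]|_]; last by left.
  by right; rewrite /box e4; lia.
(* At a down step the slide is trivial, so [K x.+1 x.+1 = K x x.+1]. The rows [a] and [j] to be
   exchanged are those of the column face. *)
have em : shape_min (h x) (h x.+1) = h x.+1.
  by rewrite shape_minC; apply: shape_min_l => k; rewrite e /box; lia.
rewrite em; rewrite em in eL1 co; rewrite eL1 slide_id -?eL1 //.
case: co => [c2 e2 _ e3|c2 a j e2 e3 e4 ci].
  by move: e; rewrite e3 => /esym/box_neq.
split.
  by rewrite shape_minC shape_min_l // => k; rewrite e3 /box; lia.
exists a, j; split; first by move=> k; rewrite e3 e4 /box; lia.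
by move: ci; rewrite /colidx; case: eqP => [_ [_ [->|]]|_ ->]; [left|right|left].
Qed.

(** Here the local rule computes [h p + h p - h p.-1], whose entry in the empty row [c] is -1. *)
Lemma del_diag_last : (0 < p.-1)%N ->
  [/\ del_diag p.-1 = h p, K p.-1 p = h p
  & exists c, h p.-1 = box (h p) c /\ h p c = 0].
Proof.
move=> x0; have [_ _ ph sh] := oh.
have [|eK [c [eL L0c]]] := @del_label_first p.-1; first by lia.
have ep : p.-1.+1 = p by lia.
have eLp : L p.-1 p = h p.
  have em := label_offdiag h p.-1; rewrite ep in em.
  rewrite label_diag em in eL.
  have [|[b e]|[b e]] := sh p.-1; first by lia.
    rewrite ep in e; move: eL; rewrite shape_min_l; last by move=> k; rewrite e /box; lia.
    by move=> /esym/box_neq.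
  by rewrite em ep in e *; rewrite shape_minC shape_min_l // => k; rewrite e /box; lia.
rewrite label_diag in eL; rewrite /del_diag eK del_label_ge // eLp; split=> //.
by exists c; rewrite -eLp.
Qed.

Lemma del_diag_ge x : (p <= x)%N -> del_diag x = h x.
Proof. by move=> lx; rewrite /del_diag del_label_ge // label_diag. Qed.

Lemma del_diag_min x : (0 < x < N)%N -> K x x.+1 = shape_min (del_diag x) (del_diag x.+1).
Proof.
move=> lx; case: (ltngtP x.+1 p) => hx.
- by have [] := @del_diag_step x; try lia.
- by rewrite !del_diag_ge ?del_label_ge ?label_offdiag //; lia.
- have e : x = p.-1 by lia.
  have [|e1 e2 _] := del_diag_last; first by lia.
  rewrite e (_ : p.-1.+1 = p) ?e2 ?e1 ?del_diag_ge //; last by lia.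
  by rewrite shape_min_l.
Qed.

Lemma del_labelE x z : (0 < x <= z)%N -> (z <= N)%N -> K x z = label del_diag x z.
Proof.
move=> lx lz; apply: (@label_unique K del_diag 1 N); try lia.
- by [].
- by move=> y ly; apply: del_diag_min; lia.
- move=> y w ly lw; have fo : fomin_cell _ _ _ _ _ := @del_fomin y w ltac:(lia) ltac:(lia).
  by have [<- _] := fomin_cellE (@del_label_part y w.+1 ltac:(lia) ltac:(lia))
    (@del_label_part y.+1 w ltac:(lia) ltac:(lia)) fo.
Qed.

Lemma growth_fill_del x z : (0 < x < z)%N -> (z < N)%N -> growth_fill del_diag x z = growth_fill h x z.
Proof.
move=> lx lz; rewrite {1}/growth_fill -!del_labelE; try lia.
by have [_ <-] := fomin_cellE (@del_label_part x z.+1 ltac:(lia) ltac:(lia))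
  (@del_label_part x.+1 z ltac:(lia) ltac:(lia)) (@del_fomin x z lx lz).
Qed.

Lemma growth_fill_first z : (0 < z < N)%N -> growth_fill h 0 z = Posz (z.+1 == p).
Proof.
move=> lz; rewrite /growth_fill !(label_first oh); try lia.
case: (ltngtP z.+1 p) => hz.
- by rewrite /rsk_cell !L1 /box /shape0; lia.
- by rewrite /rsk_cell !L0 /shape0; lia.
- by rewrite /rsk_cell L1 ?hz ?L0 /box /shape0; lia.
Qed.

End Deletion.

Lemma deletion N h : oscillating N h -> (0 < N)%N -> exists p del_diag,
  [/\ (1 < p <= N)%N,
      forall z, (0 < z < N)%N -> growth_fill h 0 z = Posz (z.+1 == p),
      forall x z, (0 < x < z)%N -> (z < N)%N -> growth_fill del_diag x z = growth_fill h x z &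
  [/\ del_diag 1%N = shape0, forall x, (p <= x)%N -> del_diag x = h x,
      forall x, (0 < x < p)%N -> ispart (del_diag x) /\ exists c, h x = box (del_diag x) c,
      forall x, (0 < x)%N -> (x.+1 < p)%N ->
        swapped (fun k => del_diag x k + h x.+1 k - h x k) (del_diag x.+1) &
      del_diag p.-1 = h p /\ exists c, h p.-1 = box (h p) c /\ h p c = 0]].
Proof.
move=> oh N0; have [p [lp L1 L0]] := exists_first oh N0.
exists p, (del_diag h p); split=> //.
- exact: growth_fill_first.
- exact: growth_fill_del.
split.
- by rewrite /del_diag del_label1 //; lia.
- exact: del_diag_ge.
- move=> x lx; have [||pK [c eL] _] := del_label_low oh N0 lp L1 (x := x) (z := x); [lia|lia|].
  by rewrite label_diag in eL; split=> //; exists c.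
- by move=> x x0 lx; have [] := del_diag_step oh N0 lp L1 x0 lx.
- by have [|? _ ?] := del_diag_last oh N0 lp L1 L0; first by lia.
Qed.

(** * Sorting vectors *)

Section Fn.
Variable r : nat.
Implicit Types x y : 'rV[int]_r.

Definition parts x : shape := fun k => if insub k is Some i then x 0 i else 0.
Definition supported f : Prop := forall k, (r <= k)%N -> f k = 0.

Lemma parts_ord x (i : 'I_r) : parts x i = x 0 i.
Proof. by rewrite /parts valK. Qed.

Lemma parts_ge x : supported (parts x).
Proof. by move=> k lk; rewrite /parts insubF //; lia. Qed.

Lemma partsP x f : supported f -> (forall i : 'I_r, x 0 i = f i) -> parts x = f.
Proof.
move=> sf e; apply: functional_extensionality => k.
by rewrite /parts; case: insubP => [i _ <-|lk] //; rewrite sf //; lia.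
Qed.

Lemma parts_inj x y : parts x = parts y -> x = y.
Proof. by move=> e; apply/rowP => i; rewrite -!parts_ord e. Qed.

Lemma partsD x y k : parts (x + y) k = parts x k + parts y k.
Proof. by rewrite /parts; case: insubP => [i _ _|_]; rewrite ?mxE ?addr0. Qed.
Lemma partsN x k : parts (- x) k = - parts x k.
Proof. by rewrite /parts; case: insubP => [i _ _|_]; rewrite ?mxE ?oppr0. Qed.
Lemma parts0 k : parts 0 k = 0.
Proof. by rewrite /parts; case: insubP => [i _ _|_]; rewrite ?mxE. Qed.
Lemma parts2 x k : parts (x *+ 2) k = parts x k *+ 2.
Proof. by rewrite !mulr2n partsD. Qed.
Definition partsE := (partsD, partsN, parts2, parts0).

Definition swap_idx (a j k : nat) : nat := if k == a then j else if k == j then a else k.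

(** Sorting is never executed: a weakly decreasing rearrangement of the absolute values is unique,
    and a transposition supplies one. *)
Lemma dom_swap_idx x f a j : ispart f -> supported f -> a = j \/ (a < r)%N && (j < r)%N ->
  (forall k, (k < r)%N -> `|parts x k| = f (swap_idx a j k)) -> parts (dom x) = f.
Proof.
move=> pf sf haj hx; apply: partsP => // i.
have [s hs] : exists s : {perm 'I_r}, forall k : 'I_r, `|x 0 (s k)| = f k.
  case: haj => [eaj|/andP[la lj]].
    exists 1%g => k; rewrite perm1 -parts_ord hx // eaj /swap_idx.
    by case: eqP => [->|].
  exists (tperm (Ordinal la) (Ordinal lj)) => k; rewrite -parts_ord hx //; congr f.
  rewrite /swap_idx; case: tpermP => [->|->|] /=; first by rewrite eqxx; case: eqP.
    by rewrite eqxx.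
  by move=> /eqP n1 /eqP n2; rewrite -!val_eqE /= in n1 n2; rewrite (negbTE n1) (negbTE n2).
rewrite mxE.
have -> : sort (fun a b : int => b <= a) [seq `|x 0 k| | k <- enum 'I_r] =
          [seq f k | k <- iota 0 r].
  apply: (@sorted_eq _ (fun a b : int => b <= a)).
  - by move=> u v w h1 h2; apply: le_trans h2 h1.
  - by move=> u v; rewrite andbC; apply: le_anti.
  - by apply: sort_sorted => u v; apply: le_total.
  - rewrite sorted_map; apply: (sub_sorted (e := leq)); last exact: iota_sorted.
    by move=> u v; apply: ispart_le.
  rewrite perm_sort -val_enum_ord -map_comp.
  have -> : map (f \o val) (enum 'I_r) =
            map ((fun k => `|x 0 k|) \o s) (enum 'I_r).
    by apply: eq_map => k /=; rewrite hs.
  rewrite map_comp; apply: perm_map; rewrite perm_sym; apply: uniq_perm.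
  - by rewrite map_inj_uniq ?enum_uniq //; apply: perm_inj.
  - exact: enum_uniq.
  - move=> k; rewrite mem_enum; apply/mapP; exists (s^-1%g k); rewrite ?mem_enum //.
    by rewrite permKV.
by rewrite (nth_map 0%N) ?size_iota // nth_iota.
Qed.

Lemma dom_id x f : ispart f -> supported f -> (forall k, `|parts x k| = f k) -> parts (dom x) = f.
Proof.
move=> pf sf e; apply: (@dom_swap_idx x f 0 0) => //; first by left.
by move=> k _; rewrite e /swap_idx; case: eqP => [->|].
Qed.

(** A box of [f] beyond row [r] could only be in row [j], with [a] above it; then [f j = f a + 1]
    contradicts monotonicity. *)
Lemma swapped_supported u f : supported u -> ispart f -> swapped u f -> supported f.
Proof.
move=> su pf [a [j [e h]]] k lk.
have := e k; have := su k lk; have := e a; have := su a.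
have := @ispart_le f a k pf; have := @eq_index f j k.
have := ispart_ge0 k pf; have := ispart_ge0 a pf; case: h; lia.
Qed.

Lemma dom_swapped x f : ispart f -> swapped (parts x) f ->
  parts (dom x) = f /\ forall k, 0 <= parts x k.
Proof.
move=> pf sw; have sf := swapped_supported (parts_ge x) pf sw.
case: sw => [a [j [e h]]]; split; last first.
  move=> k; have := e k; have := ispart_ge0 k pf; have := @eq_index f k j.
  have := ispart_ge0 a pf; case: h; lia.
have [eaj|naj] := eqVneq a j.
  apply: dom_id => // k; have := e k; have := ispart_ge0 k pf; lia.
case: h => [eaj|h]; first by rewrite eaj eqxx in naj.
apply: (@dom_swap_idx x f a j) => //.
  right; apply/andP; split.
    by have := e a; have := parts_ge x (k := a); have := ispart_ge0 a pf; lia.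
  by have := sf j; have := ispart_ge0 a pf; lia.
move=> k _; rewrite /swap_idx; have := e k; case: eqP => [->|_]; last case: eqP => [->|_].
- by have := ispart_ge0 a pf; lia.
- by have := ispart_ge0 a pf; lia.
- by have := ispart_ge0 k pf; lia.
Qed.

Lemma Phi_O0 x : (forall k, 0 <= parts x k) -> Phi_O x = 0%N.
Proof.
move=> h; rewrite /Phi_O; case: existsP => // -[j].
by rewrite -parts_ord; have := h j; lia.
Qed.

Lemma Phi_O1 x k : parts x k < 0 -> Phi_O x = 1%N.
Proof.
move=> h; rewrite /Phi_O; case: existsP => // -[].
have lk : (k < r)%N by case: (ltnP k r) => // /(parts_ge x); lia.
by exists (Ordinal lk); rewrite -parts_ord.
Qed.

End Fn.

(** * Squares of the local rule *)

Lemma swapped_id u f : (forall k, u k = f k) -> swapped u f.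
Proof. by move=> e; exists 0%N, 0%N; split; [move=> k; rewrite e; lia|left]. Qed.

(** Column bumping: [j] is the first row of length at most [f a + 1]. *)
Lemma next_column f a : ispart f -> ispart (box f a) -> exists j,
  [/\ (j <= a)%N, j = a \/ f j = f a + 1 & ispart (box (box f a) j)].
Proof.
move=> pf pa; have exP : exists j, f j <= f a + 1 by exists a; lia.
case: (ex_minnP exP) => j hj minj; exists j.
have lja : (j <= a)%N by apply: minj; lia.
have ej : j = a \/ f j = f a + 1.
  have [->|n] := eqVneq j a; [by left|right].
  have := pa a.-1; have := ispart_le (i := j) (j := a.-1) pf.
  by rewrite prednK /box; lia.
split=> // k; have := minj k; have := pf k; have := pa k; have := pa k.+1.
have := @eq_index f k a; have := @eq_index f k j; have := @eq_index f k.+1 j; have := @eq_index f k.+1 a.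
by rewrite /box; case: ej => ej; lia.
Qed.

(** Inverse of the column bump: the lowest row with the length of row [a] ends in a removable
    box. *)
Lemma last_equal r f a : supported r f -> ispart f -> 0 < f a -> exists j,
  [/\ (a <= j)%N, f j = f a & ispart (unbox f j)].
Proof.
move=> sf pf fa; have exP : exists j, f a <= f j by exists a.
have bP j : f a <= f j -> (j <= r)%N.
  by move=> h; case: (leqP j r) => // /ltnW /sf; lia.
case: (ex_maxnP exP bP) => j hj maxj; exists j.
have laj : (a <= j)%N by apply: maxj.
have ej : f j = f a by have := ispart_le pf laj; lia.
split=> // k; have := maxj k; have := maxj k.+1; have := pf k.
have := @eq_index f k j; have := @eq_index f k.+1 j.
by rewrite /unbox; lia.
Qed.

Lemma union_part f a b : a <> b -> ispart (box f a) -> ispart (box f b) ->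
  ispart (box (box f a) b).
Proof.
move=> nab pa pb k; have := pa k; have := pb k; rewrite /box.
lia.
Qed.

Lemma inter_part f a b : a <> b -> ispart (box f a) -> ispart (box f b) ->
  ispart (box (box f a) b) -> ispart f.
Proof.
move=> nab pa pb pab k; have := pa k; have := pb k; have := pab k; rewrite /box.
have := pa k.+1; have := pb k.+1; rewrite /box; lia.
Qed.

Lemma adjacentC f g : adjacent f g -> adjacent g f.
Proof. by case=> h; [right|left]. Qed.

(* In the second case sorting takes the absolute value of an entry -1. *)
Definition square (A B C D : shape) : Prop :=
  (swapped (fun k => B k + C k - A k) D /\ swapped (fun k => B k + C k - D k) A)
  \/ (D = A /\ exists a, [/\ A = box B a, C = B & B a = 0]).

Lemma squareC A B C D : square A B C D -> square A C B D.
Proof.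
have E X : (fun k => B k + C k - X k) = (fun k => C k + B k - X k).
  by apply: functional_extensionality => k; rewrite (addrC (B k)).
case=> [[h1 h2]|[h1 [a [h2 h3 h4]]]]; first by left; rewrite -!E.
by right; split=> //; exists a; rewrite h3.
Qed.

Lemma square_pm A B C a b : ispart C -> B = box A a -> A = box C b ->
  ispart A -> ispart B ->
  exists D, [/\ ispart D, adjacent B D, adjacent C D & square A B C D].
Proof.
move=> pC eB eA pA pB; subst A B; exists (box C (slide_idx C b a)).
have [d [e ed]] := slide_idx_comm C b a; split.
- exact: slide_idx_part.
- by right; exists d.
- by left; exists (slide_idx C b a).
left; split.
  exists a, (slide_idx C b a); split; first by move=> k; rewrite /box; lia.
  rewrite /slide_idx; case: ifP => [/andP[/eqP-> /eqP e4]|_]; last by left.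
  by right; rewrite /box e4; lia.
exists d, b; split.
  by move=> k; have := congr1 (fun h => h k) e; rewrite /box; lia.
move: ed; rewrite /slide_idx; case: (boolP (_ && _)) => [/andP[/eqP-> /eqP e4]|_]; last by rewrite eqxx; left.
rewrite (_ : (b == b.+1) = false); last by lia.
by move=> ->; right; rewrite /box e4; lia.
Qed.

Lemma square_exists r A B C : supported r B -> ispart A -> ispart B -> ispart C ->
  adjacent A B -> adjacent A C ->
  exists D, [/\ ispart D, adjacent B D, adjacent C D & square A B C D].
Proof.
move=> sB pA pB pC [[a eB]|[a eA]] [[b eC]|[b eA']].
- subst B C; have [eab|nab] := eqVneq a b.
    subst b; have [j [lja hj pj]] := next_column pA pB.
    exists (box (box A a) j); split=> //; try by left; exists j.
    left; split.
      exists a, j; split; first by move=> k; rewrite /box; lia.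
      by case: hj => [->|hj]; [left|right; rewrite /box; lia].
    exists a, j; split; first by move=> k; rewrite /box; lia.
    by case: hj => [->|hj]; [left|right].
  exists (box (box A a) b); split; first by apply: union_part => //; apply/eqP.
  + by left; exists b.
  + by left; exists a; rewrite boxC.
  by left; split; apply: swapped_id => k; rewrite /box; lia.
- exact: square_pm eB eA' pA pB.
- have [D [h1 h2 h3 h4]] := square_pm pB eC eA pA pC.
  by exists D; split=> //; apply: squareC.
(* When [B = C], removing a second box from the same column is possible unless row [a] is already
   empty; only then does the rule reflect. *)
have [eab|nab] := eqVneq a b.
  subst b A; have eC := box_injl eA'; subst C.
  have [e0|n0] := eqVneq (B a) 0.
    exists (box B a); split=> //; try by left; exists a.
    by right; split=> //; exists a.
  have [|j [laj ej pj]] := last_equal (a := a) sB pB; first by have := ispart_ge0 a pB; lia.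
  exists (unbox B j); split=> //; try by right; exists j; rewrite unboxK.
  left; split.
    exists j, a; split; first by move=> k; rewrite /box /unbox; lia.
    by have [->|n] := eqVneq j a; [left|right; rewrite /unbox; lia].
  exists j, a; split; first by move=> k; rewrite /box /unbox; lia.
  by have [->|n] := eqVneq j a; [left|right; rewrite /box; lia].
pose E := unbox B b.
have eB : B = box E b by rewrite unboxK.
have eC : C = box E a.
  apply: functional_extensionality => k.
  by have := congr1 (fun h => h k) eA; rewrite eA' /E /box /unbox; lia.
have pE : ispart E.
  apply: (@inter_part E b a); rewrite -?eB -?eC -?eA //.
  by apply/eqP; rewrite eq_sym.
exists E; split=> //; [by right; exists b|by right; exists a|left; split].
  by apply: swapped_id => k; rewrite eA eB eC /box; lia.
by apply: swapped_id => k; rewrite eA eB eC /box; lia.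
Qed.

Section DomSquare.
Variable r : nat.
Implicit Types A B C : 'rV[int]_r.

Lemma swapped_dom (u : 'rV[int]_r) f : ispart f -> swapped (parts u) f ->
  parts (dom u) = f /\ Phi_O u = 0%N.
Proof. by move=> pf /(dom_swapped pf)[-> h]; rewrite Phi_O0. Qed.

(** [square] treats [A] and [D] alike when boxes are exchanged, and in the reflection case [D = A]
    makes the backward computation the forward one. Hence the rule and its filling are
    reversible. *)
Lemma dom_square A B C : ispart (parts A) -> ispart (parts B) -> ispart (parts C) ->
  adjacent (parts A) (parts B) -> adjacent (parts A) (parts C) ->
  let D := dom (B + C - A) in
  [/\ ispart (parts D), adjacent (parts B) (parts D), adjacent (parts C) (parts D),
      square (parts A) (parts B) (parts C) (parts D) &
      dom (B + C - D) = A /\ Phi_O (B + C - D) = Phi_O (B + C - A)].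
Proof.
move=> pA pB pC nAB nAC /=.
have [D [pD nBD nCD sq]] := square_exists (@parts_ge _ B) pA pB pC nAB nAC.
have fE X : parts (B + C - X) = (fun k => parts B k + parts C k - parts X k).
  by apply: functional_extensionality => k; rewrite !partsE.
case: (sq) => [[s1 s2]|[eD [a [eA eC Ba]]]].
  rewrite -fE in s1; have [eD Ph] := swapped_dom pD s1.
  rewrite eD Ph; rewrite -{1}eD in s2; split=> //; split.
    by apply: parts_inj; rewrite -fE in s2; have [] := swapped_dom pA s2.
  by rewrite -fE in s2; have [] := swapped_dom pA s2.
have eCB : C = B by apply: parts_inj.
have eA2 : dom (B + C - A) = A; last by rewrite !eA2; subst C D.
apply: parts_inj; apply: dom_id => //; first exact: parts_ge.
by move=> k; have := @eq_index (parts B) k a; have := ispart_ge0 k pB; rewrite fE eC eA /box; lia.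
Qed.

End DomSquare.

(** * Promotion rotates the growth diagram *)

(** Reflecting the triangle exchanges [alpha] and [delta], in which the rule is symmetric. [M] stays
    free: it is [N] for tableaux and [N.+1] for the intermediate sequences, which start at 1. *)
Lemma label_rev h h' M a b : (b <= M)%N ->
  (forall x, (a <= x <= b)%N -> h' x = h (M - x)%N) ->
  forall x z, (a <= x)%N -> (x <= z <= b)%N -> label h' x z = label h (M - z) (M - x).
Proof.
move=> lb e x z lx lz; symmetry.
apply: (@label_unique (fun x z => label h (M - z) (M - x)) h' a b) => //.
- by move=> y ly; rewrite label_diag e.
- move=> y ly; rewrite !e; [|lia|lia].
  have -> : (M - y = (M - y.+1).+1)%N by lia.
  by rewrite label_offdiag shape_minC.
move=> y w ly lw.
have -> : (M - y = (M - y.+1).+1)%N by lia.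
rewrite label_rec; last by lia.
have -> : (M - w = (M - w.+1).+1)%N by lia.
by rewrite rsk_shapeC.
Qed.

Lemma growth_fill_rev h h' M a b : (b <= M)%N ->
  (forall x, (a <= x <= b)%N -> h' x = h (M - x)%N) ->
  forall x z, (a <= x)%N -> (x < z < b)%N ->
    growth_fill h' x z = growth_fill h (M - z.+1) (M - x.+1).
Proof.
move=> lb e x z lx lz; rewrite /growth_fill !(label_rev lb e); try lia.
have -> : (M - x = (M - x.+1).+1)%N by lia.
have -> : (M - z = (M - z.+1).+1)%N by lia.
by rewrite rsk_cellC.
Qed.

Section Row.
Variable r : nat.
Implicit Types mu : nat -> 'rV[int]_r.

Fixpoint prom_row mu (c : nat) : 'rV[int]_r :=
  if c is c'.+1 then if c' is 0 then 0 else dom (prom_row mu c' + mu c - mu c')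
  else 0.
Definition row_diff mu (c : nat) : 'rV[int]_r := prom_row mu c + mu c.+1 - mu c.
(** Rotation by a single letter; [promotion] is its square. *)
Definition promotion1 N mu (c : nat) := if (c < N)%N then prom_row mu c.+1 else 0.
Definition shapes mu (x : nat) : shape := parts (mu x).

Lemma prom_rowS mu c : (0 < c)%N -> prom_row mu c.+1 = dom (row_diff mu c).
Proof. by case: c. Qed.

Lemma parts_zero : parts (0 : 'rV[int]_r) = shape0.
Proof. by apply: functional_extensionality => k; rewrite parts0. Qed.

Section Osc.
Variables (N : nat) (mu : nat -> 'rV[int]_r).
Hypothesis om : oscillating N (shapes mu).

Lemma prom_row_adjacent c : (0 < c <= N)%N ->
  ispart (parts (prom_row mu c)) /\ adjacent (shapes mu c) (parts (prom_row mu c)).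
Proof.
have [h0 _ ph sh] := om.
elim: c => [//|c IH] lc.
have [e|n] := eqVneq c 0%N.
  subst c; rewrite /= parts_zero; split; first exact: ispart_shape0.
  by rewrite -h0; apply: adjacentC; apply: sh; lia.
have [|pc sc] := IH; first by lia.
rewrite prom_rowS; last by lia.
have [|||||pD _ nD _ _] := @dom_square _ (mu c) (prom_row mu c) (mu c.+1) => //.
- by apply: ph; lia.
- by apply: ph; lia.
- by apply: sh; lia.
Qed.

Lemma prom_row_square c : (0 < c < N)%N ->
  [/\ adjacent (parts (prom_row mu c)) (parts (prom_row mu c.+1)),
      square (shapes mu c) (parts (prom_row mu c)) (shapes mu c.+1) (parts (prom_row mu c.+1)),
      dom (prom_row mu c + mu c.+1 - prom_row mu c.+1) = mu c &
      Phi_O (prom_row mu c + mu c.+1 - prom_row mu c.+1) = Phi_O (row_diff mu c)].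
Proof.
have [h0 _ ph sh] := om => lc.
have [|pc sc] := @prom_row_adjacent c; first by lia.
rewrite prom_rowS; last by lia.
have [|||||pD nB nD sq [e1 e2]] := @dom_square _ (mu c) (prom_row mu c) (mu c.+1) => //.
- by apply: ph; lia.
- by apply: ph; lia.
- by apply: sh; lia.
Qed.

Lemma promotion1_oscillating : (0 < N)%N -> oscillating N (shapes (promotion1 N mu)).
Proof.
move=> N0; rewrite /shapes /promotion1; have [h0 hN ph sh] := om; split.
- by rewrite N0 /= parts_zero.
- by rewrite ltnn parts_zero.
- move=> x lx; case: ifP => lx2; last by rewrite parts_zero; apply: ispart_shape0.
  by have [|] := @prom_row_adjacent x.+1; first by lia.
- move=> x lx; rewrite lx; case: ifP => lx2.
    by have [|] := @prom_row_square x.+1; first by lia.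
  have -> : x.+1 = N by lia.
  by rewrite parts_zero -hN; apply: adjacentC; have [|] := @prom_row_adjacent N; first by lia.
Qed.

(** Below [p] the exchanges of [deletion] become sorting steps without negative entries; from [p] on
    the row exceeds [mu] by one box, so none occurs there either. *)
Lemma deletion_row : (0 < N)%N -> exists p del_diag,
  [/\ (1 < p <= N)%N,
      forall z, (0 < z < N)%N ->
        growth_fill (shapes mu) 0 z = Posz (z.+1 == p) /\ Phi_O (row_diff mu z) = (z.+1 == p),
      forall x z, (0 < x < z)%N -> (z < N)%N -> growth_fill del_diag x z = growth_fill (shapes mu) x z,
      forall x, (0 < x < p)%N -> del_diag x = parts (prom_row mu x) &
      forall x, (p <= x)%N -> del_diag x = shapes mu x].
Proof.
move=> N0; have [h0 hN ph sh] := om.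
have [p [del_diag [lp g0 gk [k1 kp kl ks [klast [c [ec hc]]]]]]] := deletion om N0.
have fc x : parts (row_diff mu x) = fun k => parts (prom_row mu x) k + shapes mu x.+1 k - shapes mu x k.
  by apply: functional_extensionality => k; rewrite !partsE.
have kt x : (0 < x < p)%N -> del_diag x = parts (prom_row mu x).
  elim: x => [|x IH] lx; first by lia.
  have [e|n] := eqVneq x 0%N; first by subst x; rewrite k1 /= parts_zero.
  have := ks x; rewrite IH; last by lia.
  rewrite -fc prom_rowS; last by lia.
  have [|px1 _] := kl x.+1; first by lia.
  by move=> sw; have [-> _] := swapped_dom px1 (sw ltac:(lia) ltac:(lia)).
have Plow x : (0 < x)%N -> (x.+1 < p)%N -> Phi_O (row_diff mu x) = 0%N.
  move=> x0 lx; have [|px1 _] := kl x.+1; first by lia.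
  have := ks x x0 lx; rewrite kt; last by lia.
  by rewrite -fc => sw; have [_ ->] := swapped_dom px1 sw.
have ep : p.-1.+1 = p by lia.
have ek : parts (prom_row mu p.-1) = shapes mu p by rewrite -kt ?klast //; lia.
have Phigh x : (p <= x <= N)%N -> exists d, parts (prom_row mu x) = box (shapes mu x) d.
  elim: x => [|x IH] lx; first by lia.
  have [|_ nD] := @prom_row_adjacent x.+1; first by lia.
  have [e|n] := eqVneq x.+1 p.
    have [|_ sq _ _] := @prom_row_square p.-1; first by lia.
    (* At the partner an exchange is impossible, since an entry is -1. So the square is a reflection
       and the row takes the value [mu p.-1], one box above [mu p]. *)
    exists c; move: sq; rewrite e ep ek ec => -[[[a [j [sw haj]]] _]|[-> //]].
    exfalso; have [|pD _] := @prom_row_adjacent p; first by lia.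
    have := sw c; have := ispart_ge0 c pD; have := ispart_ge0 a pD.
    have := @eq_index (parts (prom_row mu p)) c j; rewrite /box hc.
    by case: haj; lia.
  have [|d eB] := IH; first by lia.
  case: nD => [//|[b eb]].
  exfalso; have [|_ + _ _] := @prom_row_square x; first by lia.
  rewrite eB eb => -[[[a [j [sw _]]] _]|[_ [a [e1 _ _]]]]; last first.
    by case: (@box2_neq (shapes mu x) d a).
  have ea : b = a by have := sw b; rewrite /box; lia.
  have ed : d = a by have := sw d; rewrite /box; lia.
  by have := sw a; rewrite ea ed /box; lia.
exists p, del_diag; split=> // z lz; split; first exact: g0.
case: (ltngtP z.+1 p) => hz.
- by rewrite Plow; lia.
- rewrite Phi_O0 // => k; have [|d ed] := Phigh z; first by lia.
  have pz : ispart (shapes mu z.+1) by apply: ph; lia.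
  by rewrite fc ed /box; have := ispart_ge0 k pz; lia.
- have -> : z = p.-1 by lia.
  by rewrite (@Phi_O1 _ _ c) // fc ek ep ec /box hc; lia.
Qed.

End Osc.

(* Reversing the promoted tableau exchanges it with the original one, and
   deleting the first letter of either gives the same intermediate sequence. *)
Lemma rotation N mu : oscillating N (shapes mu) -> (0 < N)%N ->
  [/\ forall z, (0 < z < N)%N -> growth_fill (shapes mu) 0 z = Posz (Phi_O (row_diff mu z)),
      forall x z, (0 < x < z)%N -> (z < N)%N ->
        growth_fill (shapes (promotion1 N mu)) x.-1 z.-1 = growth_fill (shapes mu) x z &
      forall x, (0 < x < N)%N ->
        growth_fill (shapes (promotion1 N mu)) x.-1 N.-1 = growth_fill (shapes mu) 0 x].
Proof.
move=> om N0; have [p [del_diag [lp g0 gk klow khigh]]] := deletion_row om N0.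
have gP z : (0 < z < N)%N -> growth_fill (shapes mu) 0 z = Posz (Phi_O (row_diff mu z)).
  by move=> lz; have [-> ->] := g0 z lz.
pose rho y := promotion1 N mu (N - y).
have orho : oscillating N (shapes rho).
  have [e0 eN ph sh] := promotion1_oscillating om N0; split.
  - by rewrite /shapes /rho subn0.
  - by rewrite /shapes /rho subnn.
  - by move=> x lx; apply: ph; lia.
  - move=> x lx; apply: adjacentC; rewrite /shapes /rho.
    by have -> : (N - x = (N - x.+1).+1)%N; [lia|apply: sh; lia].
have rhoE y : (0 < y <= N)%N -> rho y = prom_row mu (N - y).+1.
  by move=> ly; rewrite /rho /promotion1 ifT //; lia.
(* By reversibility of the squares, the row over the reversed promoted tableau runs back through
   [mu]. *)
have trho y : (0 < y <= N)%N -> prom_row rho y = mu (N - y).+1.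
  elim: y => [//|y IH] ly; have [e|n] := eqVneq y 0%N.
    subst y; rewrite /=; apply: parts_inj; have [_ eN _ _] := om.
    by rewrite parts_zero -eN; congr (parts (mu _)); lia.
  rewrite prom_rowS; last by lia.
  rewrite /row_diff IH ?rhoE; try lia.
  have -> : (N - y = (N - y.+1).+1)%N by lia.
  have [|_ _ <- _] := @prom_row_square N mu om (N - y.+1).+1; first by lia.
  by rewrite (addrC (mu _)).
have crho y : (0 < y < N)%N -> Phi_O (row_diff rho y) = Phi_O (row_diff mu (N - y)).
  move=> ly; rewrite /row_diff trho ?rhoE; try lia.
  have -> : (N - y.+1).+1 = (N - y)%N by lia.
  have [|_ _ _ <-] := @prom_row_square N mu om (N - y); first by lia.
  by rewrite (addrC (mu _)).
have [q [kap' [lq h0 hk hlow hhigh]]] := deletion_row orho N0.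
(* Both rows have their unique negative entry in the same square, numbered [q.-1] from one end and
   [p.-1] from the other. *)
have epq : p = (N - q).+2.
  have [|_ e1] := h0 q.-1; first by lia.
  have [|_ e2] := g0 (N - q.-1)%N; first by lia.
  by move: e1; rewrite crho ?e2; lia.
have kk y : (1 <= y <= N)%N -> kap' y = del_diag (N.+1 - y)%N.
  move=> ly; case: (ltnP y q) => hy.
    by rewrite hlow ?khigh ?trho /shapes; try lia; congr (parts (mu _)); lia.
  by rewrite hhigh // klow /shapes ?rhoE; try lia; congr (parts (prom_row mu _)); lia.
have rr y : (0 <= y <= N)%N -> shapes (promotion1 N mu) y = shapes rho (N - y).
  by move=> ly; rewrite /shapes /rho; congr (parts (promotion1 N mu _)); lia.
split=> // [x z lx lz|x lx].
  rewrite (growth_fill_rev (leqnn N) rr); try lia.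
  rewrite -hk; try lia.
  rewrite (growth_fill_rev (M := N.+1) _ kk); try lia.
  by rewrite -gk //; f_equal; lia.
rewrite (growth_fill_rev (leqnn N) rr); try lia.
have -> : (N - N.-1.+1 = 0)%N by lia.
have -> : (N - x.-1.+1 = N - x)%N by lia.
have [|-> e] := h0 (N - x)%N; first by lia.
rewrite -e crho; last by lia.
by rewrite gP //; do 3 f_equal; lia.
Qed.
End Row.

(** * Iterated rotation and the entries of the promotion matrix *)

Lemma adjacent_shape0 f : ispart f -> adjacent shape0 f -> f = box shape0 0.
Proof.
move=> pf [[a e]|[a e]]; last first.
  by have := congr1 (fun h => h a) e; have := ispart_ge0 a pf; rewrite /box /shape0; lia.
by case: a e => [//|a] e; move: (pf a); rewrite e /box /shape0; lia.
Qed.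

Section Row.
Variables (r N : nat).
Hypothesis N0 : (0 < N)%N.
Implicit Types mu : nat -> 'rV[int]_r.

Lemma iter_promotion1_oscillating mu s : oscillating N (shapes mu) -> oscillating N (shapes (iter s (promotion1 N) mu)).
Proof. by move=> om; elim: s => //= s IH; apply: promotion1_oscillating. Qed.

(** Both letters are shifted by [s] modulo [N]. The three cases say how many of them wrap around; if
    only [z] does, the order of the two letters is reversed. *)
Lemma iter_rotation mu s x z : oscillating N (shapes mu) -> (s <= N)%N -> (x < z < N)%N ->
  growth_fill (shapes (iter s (promotion1 N) mu)) x z =
    if (z + s < N)%N then growth_fill (shapes mu) (x + s) (z + s)
    else if (x + s < N)%N then growth_fill (shapes mu) (z + s - N) (x + s)
    else growth_fill (shapes mu) (x + s - N) (z + s - N).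
Proof.
move=> om; elim: s x z => [|s IH] x z ls lx.
  by rewrite !addn0 /= ifT //; lia.
have [_ r1 r2] := rotation (iter_promotion1_oscillating s om) N0.
rewrite iterS; have [e|n] := eqVneq z N.-1.
  have := r2 x.+1; rewrite -e /= => ->; last by lia.
  rewrite IH; [|lia|lia].
  (repeat case: ifP => ?); try (exfalso; lia);
    congr (growth_fill _ _ _); lia.
have := r1 x.+1 z.+1; rewrite /= => ->; [|lia|lia].
rewrite IH; [|lia|lia].
by rewrite !addSnnS.
Qed.

Lemma prom_row_box0 mu c : oscillating N (shapes mu) -> (0 < c <= N)%N -> parts (mu c) = shape0 ->
  parts (prom_row mu c) = box shape0 0.
Proof.
move=> om lc e; have [p n] := prom_row_adjacent om lc.
by apply: adjacent_shape0 => //; rewrite -e.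
Qed.

(** Both vectors are the single box. This is why a promotion row may start at column 2 with [mu 1]
    instead of at column 1 with the empty shape. *)
Lemma prom_row2 mu : oscillating N (shapes mu) -> (1 < N)%N -> prom_row mu 2 = mu 1%N.
Proof.
move=> om lN; apply: parts_inj; have [h0 _ ph sh] := om.
have [|p _] := prom_row_adjacent om (c := 2); first by lia.
have [|n _ _ _] := prom_row_square om (c := 1); first by lia.
transitivity (box shape0 0).
  by apply: adjacent_shape0 => //; move: n; rewrite [parts (prom_row mu 1)]parts_zero.
symmetry; apply: adjacent_shape0; first by apply: ph; lia.
by rewrite -h0; apply: sh.
Qed.

Lemma prom_aE mu c : oscillating N (shapes mu) -> (1 < c <= N)%N -> prom_a mu c = prom_row mu c.
Proof.
move=> om; elim: c => [//|c IH] lc.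
have [e|n] := eqVneq c 1%N; first by subst c; rewrite prom_row2 //; lia.
have := IH; rewrite /prom_a /= ifF; last by lia.
move=> ->; last by lia.
by case: c {IH} lc n => // c; lia.
Qed.

Lemma prom_bE mu c : oscillating N (shapes mu) -> (1 < c <= N)%N ->
  prom_b mu c = prom_row (promotion1 N mu) c.-1.
Proof.
move=> om; elim: c => [//|c IH] lc.
have [e|n] := eqVneq c 1%N; first by subst c.
have := IH; rewrite /prom_b /= ifF; last by lia.
move=> ->; last by lia.
case: c {IH} lc n => // c lc n; rewrite prom_rowS /=; last by lia.
by rewrite !prom_aE /row_diff /promotion1 ?ifT //; lia.
Qed.

End Row.

Lemma promotionE r n mu : (0 < n)%N -> oscillating n.*2 (@shapes r mu) ->
  promotion n mu = promotion1 n.*2 (promotion1 n.*2 mu).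
Proof.
move=> n0 om; apply: functional_extensionality => c; rewrite /promotion.
have N0 : (0 < n.*2)%N by lia.
case: ifP => h1.
  rewrite (prom_bE (N := n.*2)) //=; last by lia.
  by rewrite [RHS]/promotion1 ifT //; lia.
case: eqP => h2; last by rewrite [RHS]/promotion1 ifF //; lia.
have om' := promotion1_oscillating om N0.
rewrite [RHS]/promotion1 ifT; last by lia.
have -> : c.+1 = n.*2 by lia.
rewrite (prom_aE (N := n.*2)) //; last by lia.
(* The definition takes the entry from the first row where the second rotation takes it from the
   second row; over an empty last label both are the single box. *)
apply: parts_inj; rewrite !(prom_row_box0 (N := n.*2)) //; try lia.
  by have [_ + _ _] := om'.
by have [_ + _ _] := om.
Qed.

(** The second row of cells is the first row over the rotated tableau, hence by [rotation] the row
    of the second letter of [mu]. *)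
Lemma column_fillingE r N mu c : oscillating N (@shapes r mu) -> (2 < c <= N)%N ->
  Posz (column_filling (@Phi_O r) mu c) =
    growth_fill (shapes mu) 0 c.-1 + growth_fill (shapes mu) 1 c.-1.
Proof.
case: c => [|[|[|c]]] // om lc; have N0 : (0 < N)%N by lia.
have [r0 r1 _] := rotation om N0.
have om' := promotion1_oscillating om N0; have [r0' _ _] := rotation om' N0.
rewrite /= -(r1 1%N c.+2) ?r0 ?r0'; try lia.
rewrite /column_filling !(prom_aE (N := N)) ?(prom_bE (N := N)) //; try lia.
rewrite PoszD /row_diff /promotion1 !ifT; try lia.
by [].
Qed.

Definition block_sum (h : nat -> shape) (a b : nat) : int :=
  growth_fill h a.*2 b.*2 + growth_fill h a.*2.+1 b.*2
  + (growth_fill h a.*2 b.*2.+1 + growth_fill h a.*2.+1 b.*2.+1).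

Lemma iter_promotionE r n mu s : (0 < n)%N -> oscillating n.*2 (@shapes r mu) ->
  iter s (promotion n) mu = iter s.*2 (promotion1 n.*2) mu.
Proof.
move=> n0 om; have N0 : (0 < n.*2)%N by lia.
elim: s => // s IH; rewrite iterS IH promotionE //.
exact: iter_promotion1_oscillating.
Qed.

Lemma promotion_matrix_O r n mu (i j : 'I_n) : oscillating n.*2 (@shapes r mu) -> i != j ->
  promotion_matrix n (@Phi_O r) mu i j =
    if (i < j)%N then block_sum (shapes mu) i j else block_sum (shapes mu) j i.
Proof.
move=> om nij; rewrite mxE (negbTE nij).
have n0 : (0 < n)%N by have := ltn_ord i; lia.
have N0 : (0 < n.*2)%N by lia.
rewrite iter_promotionE //.
have ho := iter_promotion1_oscillating N0 i.*2 om.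
have li := ltn_ord i; have lj := ltn_ord j.
have nn : (i : nat) <> j by move=> e; move: nij; rewrite -val_eqE /= e eqxx.
pose m := ((j + n - i) %% n)%N.
have em : m = if (i < j)%N then (j - i)%N else (j + n - i)%N.
  rewrite /m; case: ifP => lij; last by rewrite modn_small //; lia.
  by rewrite (_ : j + n - i = j - i + n)%N ?modnDr ?modn_small //; lia.
have hm : (0 < m < n)%N by move: em; case: ifP => lij ->; lia.
cbv zeta; rewrite -/m; clearbody m.
have -> (a b : nat) : Posz (a + b)%R = Posz a + Posz b by [].
rewrite !(column_fillingE (N := n.*2)) //; try lia.
rewrite !iter_rotation //; try lia.
rewrite /block_sum; case: ifP em => lij em.
  (repeat case: ifP => ?); try (exfalso; lia).
  by congr (growth_fill _ _ _ + growth_fill _ _ _ + (growth_fill _ _ _ + growth_fill _ _ _)); lia.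
(* When the letters of the second index wrap around, the block appears transposed, so its two middle
   summands trade places. *)
have e1 a b c d : a + b + (c + d) = a + c + (b + d) :> int by lia.
rewrite [RHS]e1.
(repeat case: ifP => ?); try (exfalso; lia).
by congr (growth_fill _ _ _ + growth_fill _ _ _ + (growth_fill _ _ _ + growth_fill _ _ _)); lia.
Qed.

(** * Blocks of two by two cells *)

(* The strip b / a lies to the left of the strip c / b. *)
Definition split_at (a b c : shape) : Prop := exists t,
  (forall k, (k < t)%N -> b k = a k) /\ (forall k, (t < k)%N -> b k = c k).

(** Every row except [t] meets only one of the two strips, so the minima, maxima and carries of two
    stacked cells combine into those of a single cell. *)
Lemma split_compose alpha b1 b2 d2 :
  (forall k, alpha k <= b1 k) -> (forall k, b1 k <= b2 k) -> (forall k, d2 k <= b2 k) ->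
  split_at alpha b1 b2 ->
  let d1 := rsk_shape b1 b2 d2 in
  [/\ rsk_shape alpha b1 d1 = rsk_shape alpha b2 d2,
      rsk_cell b1 b2 d2 + rsk_cell alpha b1 d1 = rsk_cell alpha b2 d2
    & split_at (rsk_shape alpha b1 d1) d1 d2].
Proof.
move=> h1 h2 h3 [t [tl tr]] /=; split.
- apply: functional_extensionality => k; rewrite /rsk_shape.
  have := tl k; have := tl k.+1; have := tr k; have := tr k.+1; have := tr k.+2.
  have := tl k.+2.
  have := h1 k; have := h2 k; have := h3 k; have := h1 k.+1; have := h2 k.+1; have := h3 k.+1.
  have := h1 k.+2; have := h2 k.+2; have := h3 k.+2.
  by case: (ltngtP k t) => ?; case: (ltngtP k.+1 t) => ?; lia.
- rewrite /rsk_cell /rsk_shape.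
  have := tl 0%N; have := tl 1%N; have := tr 0%N; have := tr 1%N.
  have := h1 0%N; have := h2 0%N; have := h3 0%N; have := h1 1%N; have := h2 1%N; have := h3 1%N.
  by case: (ltngtP 0%N t) => ?; case: (ltngtP 1%N t) => ?; lia.
(* Here [d1 t] is the minimum of [b1 t] and [d2 t]. If it is [d2 t], row [t] already agrees with
   [d2] and the dividing row, which is unconstrained, moves up; at [t = 0] it stays. *)
exists (if d2 t <= b1 t then t.-1 else t).
split=> k; rewrite /rsk_shape.
  have := tl k; have := tl k.+1; have := tr k; have := tr k.+1; have := tr k.+2.
  have := tl k.+2; have := @eq_index d2 k.+1 t; have := @eq_index b1 k.+1 t.
  have := h1 k; have := h2 k; have := h3 k; have := h1 k.+1; have := h2 k.+1; have := h3 k.+1.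
  have := h1 k.+2; have := h2 k.+2; have := h3 k.+2.
  by case: ifP => ? ; case: (ltngtP k.+1 t) => ?; case: (ltngtP k.+2 t) => ?; lia.
have := tl k; have := tl k.+1; have := tr k; have := tr k.+1.
have := @eq_index d2 k t; have := @eq_index b1 k t.
have := h1 k; have := h2 k; have := h3 k; have := h1 k.+1; have := h2 k.+1; have := h3 k.+1.
by case: ifP => ?; case: (ltngtP k t) => ?; lia.
Qed.

Section Coarse.
Variables (n : nat) (h : nat -> shape).
Hypothesis oh : oscillating n.*2 h.
Local Notation L := (label h).
Hypothesis hbase : forall i, (i < n)%N ->
  split_at (L i.*2 i.*2.+2) (L i.*2.+1 i.*2.+2) (L i.*2.+2 i.*2.+2).
Hypothesis vbase : forall i, (i < n)%N ->
  split_at (L i.*2 i.*2.+2) (L i.*2 i.*2.+1) (L i.*2 i.*2).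

Lemma label_le1 x z k : (x < z <= n.*2)%N -> L x z k <= L x.+1 z k.
Proof. by move=> l; apply: weak_cover_le; apply: (label_cover_x oh). Qed.
Lemma label_le2 x z k : (x <= z < n.*2)%N -> L x z.+1 k <= L x z k.
Proof. by move=> l; apply: weak_cover_le; apply: (label_cover_z oh). Qed.

Lemma hcompose i z : (i.*2.+2 <= z < n.*2)%N ->
  split_at (L i.*2 z) (L i.*2.+1 z) (L i.*2.+2 z) ->
  [/\ L i.*2 z.+1 = rsk_shape (L i.*2 z) (L i.*2.+2 z) (L i.*2.+2 z.+1),
      growth_fill h i.*2.+1 z + growth_fill h i.*2 z = rsk_cell (L i.*2 z) (L i.*2.+2 z) (L i.*2.+2 z.+1)
    & split_at (L i.*2 z.+1) (L i.*2.+1 z.+1) (L i.*2.+2 z.+1)].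
Proof.
move=> lz sp; rewrite /growth_fill.
have e1 : L i.*2.+1 z.+1 = rsk_shape (L i.*2.+1 z) (L i.*2.+2 z) (L i.*2.+2 z.+1).
  by rewrite label_rec; [|lia].
have e2 : L i.*2 z.+1 = rsk_shape (L i.*2 z) (L i.*2.+1 z) (L i.*2.+1 z.+1).
  by rewrite label_rec; [|lia].
have [|||] := split_compose _ _ _ sp (d2 := L i.*2.+2 z.+1).
- by move=> k; apply: label_le1; lia.
- by move=> k; apply: label_le1; lia.
- by move=> k; apply: label_le2; lia.
by rewrite -e1 -e2.
Qed.

Lemma hsplit i z : (i.*2.+2 <= z <= n.*2)%N ->
  split_at (L i.*2 z) (L i.*2.+1 z) (L i.*2.+2 z).
Proof.
elim: z => [|z IH] lz; first by lia.
have [e|ne] := eqVneq z i.*2.+1; first by subst z; apply: hbase; lia.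
by have [_ _ //] := @hcompose i z ltac:(lia) (IH ltac:(lia)).
Qed.

Lemma vsplit x j : (x <= j.*2)%N -> (j < n)%N ->
  split_at (L x j.*2.+2) (L x j.*2.+1) (L x j.*2).
Proof.
move=> lx lj; have [d] := ubnP (j.*2 - x); elim: d x lx => // d IH x lx ld.
have [->|ne] := eqVneq x j.*2; first exact: vbase.
have sp := IH x.+1 ltac:(lia) ltac:(lia).
have e1 : L x j.*2.+1 = rsk_shape (L x.+1 j.*2.+1) (L x.+1 j.*2) (L x j.*2).
  by rewrite label_rec; [exact: rsk_shapeC|lia].
have e2 : L x j.*2.+2 = rsk_shape (L x.+1 j.*2.+2) (L x.+1 j.*2.+1) (L x j.*2.+1).
  by rewrite label_rec; [exact: rsk_shapeC|lia].
have [|||] := split_compose _ _ _ sp (d2 := L x j.*2).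
- by move=> k; apply: label_le2; lia.
- by move=> k; apply: label_le2; lia.
- by move=> k; apply: label_le1; lia.
by rewrite -e1 -e2.
Qed.

(** Pairs of columns are merged in the two rows of the block by [hcompose]; the two wide cells are
    then merged along the vertical split. *)
Lemma coarse_cell i j : (i < j < n)%N ->
  L i.*2 j.*2.+2 = rsk_shape (L i.*2 j.*2) (L i.*2.+2 j.*2) (L i.*2.+2 j.*2.+2) /\
  block_sum h i j = rsk_cell (L i.*2 j.*2) (L i.*2.+2 j.*2) (L i.*2.+2 j.*2.+2).
Proof.
move=> lij.
have [||e1 f1 _] := @hcompose i j.*2; [lia|apply: hsplit; lia|].
have [||e2 f2 _] := @hcompose i j.*2.+1; [lia|apply: hsplit; lia|].
have [|||] := split_compose _ _ _ (@vsplit i.*2.+2 j ltac:(lia) ltac:(lia)) (d2 := L i.*2 j.*2).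
- by move=> k; apply: label_le2; lia.
- by move=> k; apply: label_le2; lia.
- move=> k; apply: le_trans (label_le1 k (x := i.*2.+1) (z := j.*2) _); last by lia.
  by apply: label_le1; lia.
rewrite (rsk_shapeC _ _ (L i.*2 j.*2)) -e1 rsk_shapeC -e2 rsk_shapeC => -> + _.
rewrite rsk_cellC -f1 rsk_cellC -f2 rsk_cellC => <-; split=> //.
by rewrite /block_sum; lia.
Qed.

End Coarse.

(** * The backward loop in closed form *)

Section Rsk.
Variable r : nat.
Implicit Types alpha beta delta : 'rV[int]_r.

Lemma nth_parts (x : 'rV[int]_r) k : (k < r)%N -> nth 0 [seq x 0 j | j <- enum 'I_r] k = parts x k.
Proof.
move=> lk; rewrite (nth_map (Ordinal lk)) ?size_enum_ord //.
by rewrite -parts_ord nth_enum_ord.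
Qed.

Lemma rsk_loopE alpha beta delta i c s : (i <= r)%N ->
  c = parts beta i - Num.max (parts delta i) (parts alpha i) ->
  rsk_loop alpha beta delta i c s =
    (mkseq (rsk_shape (parts alpha) (parts beta) (parts delta)) i ++ s,
     rsk_cell (parts alpha) (parts beta) (parts delta)).
Proof.
elim: i c s => [|i IH] c s li ec; first by rewrite /= ec /rsk_cell maxC.
rewrite [LHS]/= IH; [|by lia|by rewrite !nth_parts].
rewrite mkseqS -cats1 -catA /= !nth_parts // ec /rsk_shape; congr (_ ++ _ :: _, _).
lia.
Qed.

(** Starting at the last nonempty row of [beta] with carry 0 agrees with the closed form, since
    [alpha] and [delta] lie inside [beta] and all three vanish below that row. *)
Lemma rsk_backwardE alpha beta delta :
  ispart (parts alpha) -> ispart (parts beta) -> ispart (parts delta) ->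
  (forall k, parts alpha k <= parts beta k) -> (forall k, parts delta k <= parts beta k) ->
  parts (rsk_gamma alpha beta delta) = rsk_shape (parts alpha) (parts beta) (parts delta) /\
  rsk_filling alpha beta delta = rsk_cell (parts alpha) (parts beta) (parts delta).
Proof.
move=> pa pb pd la ld.
have e0 k : parts beta k = 0 -> parts alpha k = 0 /\ parts delta k = 0.
  by have := la k; have := ld k; have := ispart_ge0 k pa; have := ispart_ge0 k pd; lia.
pose m := (\max_(j < r | (0 < beta 0 j)%R) j.+1)%N.
have lm : (m <= r)%N by apply/bigmax_leqP => j _; apply: ltn_ord.
have hm k : (m <= k)%N -> parts beta k = 0.
  move=> lk; case: (ltnP k r) => [lkr|]; last exact: parts_ge.
  have := ispart_ge0 k pb; have := @leq_bigmax_cond _ (fun j : 'I_r => 0 < beta 0 j) (fun j => j.+1) (Ordinal lkr).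
  by rewrite -parts_ord /= -/m; lia.
have e : rsk_backward alpha beta delta =
   (mkseq (rsk_shape (parts alpha) (parts beta) (parts delta)) m, rsk_cell (parts alpha) (parts beta) (parts delta)).
  rewrite /rsk_backward rsk_loopE ?cats0 //.
  by have [-> ->] := e0 _ (hm m (leqnn m)); rewrite -/m hm.
have h0 k : (m <= k)%N -> rsk_shape (parts alpha) (parts beta) (parts delta) k = 0.
  move=> lk; rewrite /rsk_shape.
  have [-> ->] := e0 _ (hm k lk).
  by have [-> ->] := e0 _ (hm k.+1 (leqW lk)); rewrite hm //; lia.
split; last by rewrite /rsk_filling e.
apply: partsP => [k lk|i]; first by apply: h0; lia.
rewrite mxE e /=; case: (ltnP i m) => h; first by rewrite nth_mkseq.
by rewrite nth_default ?size_mkseq ?h0.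
Qed.

End Rsk.

(** * Doubling a vacillating tableau *)

Inductive halves (P M Q : shape) : Prop :=
| HUp a of M = box P a & Q = box M a
| HDown a of M = box Q a & P = box M a
| HStay a of P = box M a & Q = box M a.

Lemma shape_min_box f a : shape_min f (box f a) = f.
Proof. by apply: shape_min_l => k; rewrite /box; lia. Qed.

(** Initial conditions for [split_compose]. The two boxes of an up or down step lie in one row, so
    the strips are ordered from left to right there. *)
Lemma halves_labels P M Q : halves P M Q ->
  [/\ split_at (rsk_shape (shape_min P M) M (shape_min M Q)) (shape_min M Q) Q,
      split_at (rsk_shape (shape_min P M) M (shape_min M Q)) (shape_min P M) P &
      rsk_shape (shape_min P M) M (shape_min M Q) = shape_min (shape_min P M) (shape_min M Q)].
Proof.
have S f : split_at f f f by exists 0%N.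
have S1 f a : split_at f (box f a) (box (box f a) a).
  by exists a; split=> k lk; rewrite /box; lia.
have S2 f a : split_at f f (box f a) by exists a; split=> k lk; rewrite /box; lia.
have G1 f a : rsk_shape f (box f a) (box f a) = f.
  by apply: functional_extensionality => k; rewrite /rsk_shape /box; lia.
have G0 f : rsk_shape f f f = f.
  by apply: functional_extensionality => k; rewrite /rsk_shape; lia.
case=> a -> ->.
- by rewrite shape_min_box shape_min_box G1 shape_min_box.
- by rewrite [shape_min (box (box _ _) _) _]shape_minC [shape_min (box Q a) Q]shape_minC !shape_min_box rsk_shapeC G1 shape_minC shape_min_box.
- by rewrite [shape_min (box _ _) _]shape_minC !shape_min_box G0 shape_min_l.
Qed.

Lemma half_cases x : exists i, x = i.*2 \/ x = i.*2.+1.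
Proof. by exists x./2; have := odd_double_half x; case: (odd x); lia. Qed.

Section Vac.
Variable r : nat.
Implicit Types A B : 'rV[int]_r.

Lemma is_partitionP A : is_partition A <-> ispart (parts A).
Proof.
split=> [[p0 pd] k|p].
  case: (ltnP k.+1 r) => lk; last first.
    rewrite (parts_ge _ lk); case: (ltnP k r) => lk2; last by rewrite (parts_ge _ lk2).
    by rewrite -[k]/(nat_of_ord (Ordinal lk2)) parts_ord.
  have lk2 : (k < r)%N by lia.
  rewrite -[k.+1]/(nat_of_ord (Ordinal lk)) -[k in _ <= parts _ k]/(nat_of_ord (Ordinal lk2)).
  by rewrite !parts_ord; split; [apply: p0|apply: pd; rewrite /=; lia].
split=> [i|i j lij]; rewrite -!parts_ord; first exact: ispart_ge0.
exact: ispart_le.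
Qed.

Lemma parts_delta (i : 'I_r) k : parts (delta_mx 0 i : 'rV[int]_r) k = Posz (k == i).
Proof.
case: (ltnP k r) => lk; last by rewrite (parts_ge _ lk); have := ltn_ord i; lia.
by rewrite -[k]/(nat_of_ord (Ordinal lk)) parts_ord mxE eqxx /= -val_eqE /=; case: eqP.
Qed.

Lemma add_boxP A B : reflect (exists a, parts B = box (parts A) a) (add_box A B).
Proof.
apply: (iffP existsP) => [[k /eqP->]|[a e]].
  exists k; apply: functional_extensionality => l.
  by rewrite partsD parts_delta.
have la : (a < r)%N.
  case: (ltnP a r) => // la; have := parts_ge B la; rewrite e /box (parts_ge _ la); lia.
exists (Ordinal la); apply/eqP; apply: parts_inj; rewrite e.
by apply: functional_extensionality => l; rewrite partsD parts_delta.
Qed.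

Definition vstep A B : Prop :=
  adjacent (parts A) (parts B) \/ A = B /\ forall k, (k < r)%N -> 0 < parts A k.

Definition vacillating n (lam : nat -> 'rV[int]_r) : Prop :=
  [/\ lam 0%N = 0, lam n = 0, forall i, (i <= n)%N -> ispart (parts (lam i))
    & forall i, (i < n)%N -> vstep (lam i) (lam i.+1)].

Lemma vacillatingP n (V : n.+1.-tuple 'rV[int]_r) : vacillating_tableau V -> vacillating n (nth 0 V).
Proof.
case=> h0 hn hp hs; split=> // [i li|i li]; first by apply/is_partitionP/hp.
case: (hs i li) => [[e p]|/add_boxP h|/add_boxP h].
- right; split=> // k lk.
  by rewrite -[k]/(nat_of_ord (Ordinal lk)) parts_ord.
- by left; left.
- by left; right.
Qed.

Definition midO A B := if A != B then A + B else A + B - e_last r.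

Lemma iota_VO_even lam i : iota_VO lam i.*2 = lam i *+ 2 :> 'rV[int]_r.
Proof. by rewrite /iota_VO odd_double doubleK. Qed.
Lemma iota_VO_odd lam i : iota_VO lam i.*2.+1 = midO (lam i) (lam i.+1) :> 'rV[int]_r.
Proof. by rewrite /iota_VO /= odd_double /= uphalf_double. Qed.

Lemma adjacent_neq A B : adjacent (parts A) (parts B) -> A != B.
Proof.
move=> h; apply/eqP => e; subst B; case: h => -[a e]; exact: (@box_neq (parts A) a (esym e)).
Qed.

Lemma ispart2 A : ispart (parts A) -> ispart (parts (A *+ 2)).
Proof. by move=> p k; rewrite !partsE; have := p k; lia. Qed.

Hypothesis r0 : (0 < r)%N.

Lemma parts_e_last k : parts (e_last r) k = Posz (k == r.-1).
Proof.
case: (ltnP k r) => lk; last by rewrite (parts_ge _ lk); lia.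
rewrite -[k]/(nat_of_ord (Ordinal lk)) parts_ord mxE /=.
have -> : (k.+1 == r) = (k == r.-1) by lia.
by case: eqP.
Qed.

Lemma midO_halves A B : vstep A B ->
  halves (parts (A *+ 2)) (parts (midO A B)) (parts (B *+ 2)).
Proof.
case=> [h|[<- p]]; last first.
  apply: (HStay (a := r.-1)); apply: functional_extensionality => k;
    by rewrite /midO eqxx /= /box !partsE parts_e_last; lia.
rewrite /midO (adjacent_neq h); case: h => -[a e]; [apply: (HUp (a := a))|apply: (HDown (a := a))];
  apply: functional_extensionality => k; rewrite /= /box !(partsE, e) /box; lia.
Qed.

Lemma midO_part A B : ispart (parts A) -> ispart (parts B) -> vstep A B -> ispart (parts (midO A B)).
Proof.
move=> pA pB; case=> [h|[<- p]] k.
  by rewrite /midO (adjacent_neq h) !partsE; have := pA k; have := pB k; lia.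
rewrite /midO eqxx /= !partsE !parts_e_last.
have := pA k; have := pA k.+1; have := p k; have := p k.+1.
by have := @parts_ge r A k.+1; lia.
Qed.

Lemma halves_adjacent P M Q : halves P M Q -> adjacent P M /\ adjacent M Q.
Proof. by case=> a -> ->; split; try (left; exists a; done); right; exists a. Qed.

Lemma double0 : parts ((0 : 'rV[int]_r) *+ 2) = shape0.
Proof. by rewrite mul0rn parts_zero. Qed.

Section Tableau.
Variables (n : nat) (lam : nat -> 'rV[int]_r).
Hypothesis vl : vacillating n lam.
Local Notation H := (shapes (iota_VO lam)).
Local Notation L := (label H).

Lemma iota_VO_halves i : (i < n)%N -> halves (H i.*2) (H i.*2.+1) (H i.*2.+2).
Proof.
have [_ _ _ st] := vl => li.
by rewrite /shapes -doubleS !iota_VO_even iota_VO_odd; apply: midO_halves; apply: st.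
Qed.

Lemma iota_VO_oscillating : oscillating n.*2 H.
Proof.
have [l0 ln pl st] := vl; split.
- by rewrite /shapes -[0%N]/(0.*2) iota_VO_even l0 double0.
- by rewrite /shapes iota_VO_even ln double0.
- move=> x lx; rewrite /shapes; have [i [e|e]] := half_cases x; subst x.
    by rewrite iota_VO_even; apply: ispart2; apply: pl; lia.
  by rewrite iota_VO_odd; apply: midO_part; [apply: pl|apply: pl|apply: st]; lia.
- move=> x lx; have [i [e|e]] := half_cases x; subst x.
    by apply: (halves_adjacent (iota_VO_halves (i := i) _)).1; lia.
  by apply: (halves_adjacent (iota_VO_halves (i := i) _)).2; lia.
Qed.

Lemma label_even i : L i.*2 i.*2.+2 =
  rsk_shape (shape_min (H i.*2) (H i.*2.+1)) (H i.*2.+1) (shape_min (H i.*2.+1) (H i.*2.+2)).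
Proof. by rewrite label_rec ?label_offdiag ?label_diag //; lia. Qed.

(** The second diagonal, prescribed in the coarse diagram, is forced in the fine one; for equal
    neighbours its label is the midpoint of the doubled step. *)
Lemma growth_label1 i : (i < n)%N -> parts (growth_label lam 1 i) = L i.*2 i.*2.+2.
Proof.
move=> li; have [_ _ e] := halves_labels (iota_VO_halves li).
rewrite label_even e /shapes -doubleS !iota_VO_even iota_VO_odd.
have [_ _ _ st] := vl.
apply: functional_extensionality => k; rewrite /= /shape_min.
case: (st i li) => [h|[<- p]].
  rewrite /midO (adjacent_neq h) !partsE.
  have -> : parts (meet (lam i) (lam i.+1)) k = Num.min (parts (lam i) k) (parts (lam i.+1) k).
    case: (ltnP k r) => lk; last by rewrite !(parts_ge _ lk).
    by rewrite -[k]/(nat_of_ord (Ordinal lk)) !parts_ord mxE.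
  by case: h => -[a ->]; rewrite /box; lia.
by rewrite /midO eqxx /= !partsE parts_e_last; lia.
Qed.

Lemma coarse_splits i : (i < n)%N ->
  split_at (L i.*2 i.*2.+2) (L i.*2.+1 i.*2.+2) (L i.*2.+2 i.*2.+2) /\
  split_at (L i.*2 i.*2.+2) (L i.*2 i.*2.+1) (L i.*2 i.*2).
Proof.
move=> li; have [s1 s2 _] := halves_labels (iota_VO_halves li).
by rewrite label_even !label_offdiag !label_diag.
Qed.

Lemma coarse i j : (i < j < n)%N ->
  L i.*2 j.*2.+2 = rsk_shape (L i.*2 j.*2) (L i.*2.+2 j.*2) (L i.*2.+2 j.*2.+2) /\
  block_sum H i j = rsk_cell (L i.*2 j.*2) (L i.*2.+2 j.*2) (L i.*2.+2 j.*2.+2).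
Proof.
apply: (coarse_cell iota_VO_oscillating) => l ll; first exact: (coarse_splits ll).1.
exact: (coarse_splits ll).2.
Qed.

Lemma le_coarse1 x z k : (x.+2 <= z <= n.*2)%N -> L x z k <= L x.+2 z k.
Proof.
move=> l; apply: le_trans (label_le1 iota_VO_oscillating k (x := x.+1) (z := z) _); last by lia.
by apply: (label_le1 iota_VO_oscillating); lia.
Qed.
Lemma le_coarse2 x z k : (x <= z)%N -> (z.+2 <= n.*2)%N -> L x z.+2 k <= L x z k.
Proof.
move=> l1 l2; apply: le_trans (label_le2 iota_VO_oscillating k (x := x) (z := z) _); last by lia.
by apply: (label_le2 iota_VO_oscillating); lia.
Qed.

Lemma growth_labelE d x : (x + d <= n)%N ->
  parts (growth_label lam d x) = L x.*2 (x + d).*2.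
Proof.
have [m] := ubnP d; elim: m d x => // m IH [|[|d]] x ld lx.
- by rewrite addn0 label_diag /= /shapes iota_VO_even.
- by rewrite growth_label1 ?addn1 //; lia.
have e0 := IH d.+1 x ltac:(lia) ltac:(lia).
have e1 := IH d x.+1 ltac:(lia) ltac:(lia).
have e2 := IH d.+1 x.+1 ltac:(lia) ltac:(lia).
rewrite -[growth_label _ _ _]/(rsk_gamma (growth_label lam d.+1 x)
  (growth_label lam d x.+1) (growth_label lam d.+1 x.+1)).
have pL := @label_part _ _ iota_VO_oscillating.
move: e0 e1 e2; rewrite !addSn !addnS !doubleS => e0 e1 e2.
have [|||||-> _] := @rsk_backwardE r (growth_label lam d.+1 x)
  (growth_label lam d x.+1) (growth_label lam d.+1 x.+1);
  rewrite ?e0 ?e1 ?e2; try (apply: pL; lia).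
- by move=> k; apply: le_coarse1; lia.
- by move=> k; apply: le_coarse2; lia.
have [|-> _] := @coarse x (x + d).+1; first by lia.
by rewrite !doubleS.
Qed.

Lemma growth_fillingE i j : (j < i < n)%N ->
  growth_filling n lam j.+1 (n - i) = block_sum H j i.
Proof.
move=> lij; rewrite /growth_filling /=.
have -> : (n - (j.+1 + (n - i)) = i - j.+1)%N by lia.
have e0 := @growth_labelE (i - j.+1).+1 j ltac:(lia).
have e1 := @growth_labelE (i - j.+1) j.+1 ltac:(lia).
have e2 := @growth_labelE (i - j.+1).+1 j.+1 ltac:(lia).
have pL := @label_part _ _ iota_VO_oscillating.
have E0 : (j + (i - j.+1).+1 = i)%N by lia.
have E1 : (j.+1 + (i - j.+1) = i)%N by lia.
have E2 : (j.+1 + (i - j.+1).+1 = i.+1)%N by lia.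
rewrite E0 in e0; rewrite E1 doubleS in e1; rewrite E2 !doubleS in e2.
have [|||||_ ->] := rsk_backwardE (alpha := growth_label lam (i - j.+1).+1 j)
  (beta := growth_label lam (i - j.+1) j.+1) (delta := growth_label lam (i - j.+1).+1 j.+1);
  rewrite ?e0 ?e1 ?e2; try (apply: pL; lia).
- by move=> k; apply: le_coarse1; lia.
- by move=> k; apply: le_coarse2; lia.
by have [|_ ->] := @coarse j i; first by lia.
Qed.

End Tableau.

Lemma G_V_M_VO n (V : n.+1.-tuple 'rV[int]_r) : vacillating_tableau V -> G_V V = M_VO V.
Proof.
move=> /vacillatingP vl; apply/matrixP => i j; rewrite [LHS]mxE /M_VO.
have li := ltn_ord i; have lj := ltn_ord j.
have [e|ne] := eqVneq i j; first by subst j; rewrite ltnn mxE eqxx.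
rewrite (promotion_matrix_O (iota_VO_oscillating vl) ne).
have nn : (i : nat) <> j by move=> e; move: ne; rewrite -val_eqE /= e eqxx.
by case: (ltngtP i j) nn => // lij _; rewrite growth_fillingE //; lia.
Qed.

End Vac.

(** * The block rule for both embeddings *)

Section Block.
Variable r : nat.
Implicit Types A B C D : 'rV[int]_r.

(* No vector with two negative entries occurs in the block rule. *)
Definition good_Phi (Phi : 'rV[int]_r -> nat) : Prop :=
  (forall u, (forall k, 0 <= parts u k) -> Phi u = 0%N) /\
  (forall u a, parts u a < 0 -> (forall k, k <> a -> 0 <= parts u k) -> Phi u = 1%N).

Lemma good_Phi_O : good_Phi (@Phi_O r).
Proof. by split=> [u h|u a h _]; [apply: Phi_O0|apply: (Phi_O1 h)]. Qed.

Lemma good_Phi_F : good_Phi (@Phi_F r).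
Proof.
split=> [u h|u a h h2]; rewrite /Phi_F.
  apply/eqP; rewrite cards_eq0; apply/eqP/setP => j.
  by rewrite !inE -parts_ord; have := h j; lia.
have la : (a < r)%N by case: (ltnP a r) => // /(parts_ge u); lia.
rewrite (_ : [set j | _] = [set Ordinal la]) ?cards1 //.
apply/setP => j; rewrite !inE -parts_ord -val_eqE /=.
have [->|ne] := eqVneq (j : nat) a; first by rewrite h.
by have := h2 j; lia.
Qed.

(** The three ways in which [dom] acts in a block, indexed by the filling: no change, an exchange of
    two entries differing by [c], one change of sign. In the last case [f a + f a = c] says that
    [u a = - f a]. *)
Inductive sorts_to (u f : shape) : nat -> Prop :=
| SortsId of (forall k, u k = f k) : sorts_to u f 0
| SortsSwap a j c of (forall k, u k = f k + c * Posz (k == a) - c * Posz (k == j)) & 0 <= c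
    & a = j \/ [/\ f j = f a + c, (a < r)%N & (j < r)%N] : sorts_to u f 0
| SortsNeg a c of (forall k, u k = f k - c * Posz (k == a)) & 0 < c & f a + f a = c : sorts_to u f 1.

Lemma sorts_toP Phi (u : 'rV[int]_r) w f p : good_Phi Phi -> ispart f -> supported r f ->
  (forall k, parts u k = w k) -> sorts_to w f p -> parts (dom u) = f /\ Phi u = p.
Proof.
move=> [P0 P1] pf sf e [h|a j c h c0 haj|a c h c0 hc].
- split; first by apply: dom_id => // k; rewrite e h; have := ispart_ge0 k pf; lia.
  by apply: P0 => k; rewrite e h; apply: ispart_ge0.
- have [eaj|naj] := eqVneq a j.
    have h' k : parts u k = f k by rewrite e h eaj; lia.
    split; first by apply: dom_id => // k; rewrite h'; have := ispart_ge0 k pf; lia.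
    by apply: P0 => k; rewrite h'; apply: ispart_ge0.
  case: haj => [eaj|[fj la lj]]; first by rewrite eaj eqxx in naj.
  have pa := ispart_ge0 a pf.
  split; last first.
    apply: P0 => k; rewrite e h; have := ispart_ge0 k pf; have := @eq_index f k j.
    by case: (eqVneq k a); case: (eqVneq k j); lia.
  apply: (@dom_swap_idx r u f a j) => //; first by right; rewrite la lj.
  move=> k _; rewrite /swap_idx e h; have := ispart_ge0 k pf.
  case: (eqVneq k a) => [->|_] /=.
    by rewrite (negbTE naj); lia.
  by case: (eqVneq k j) => [->|_] /=; lia.
split.
  apply: dom_id => // k; rewrite e h; have := ispart_ge0 k pf.
  by case: (eqVneq k a) => [->|_]; lia.
apply: (P1 u a).
  by rewrite e h eqxx; lia.
move=> k nk; rewrite e h; have := ispart_ge0 k pf.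
have -> : (k == a) = false by lia.
by lia.
Qed.

(* A 2 x 2 block of the local rule, with top left corner 2A, top right 2B and
   bottom left 2C; X is its centre. *)
Definition block_rule (mid : 'rV[int]_r -> 'rV[int]_r -> 'rV[int]_r) (Phi : 'rV[int]_r -> nat)
    A B C D (m : nat) : Prop :=
  let T := mid A B in let S := mid A C in
  let X := dom (S + T - A *+ 2) in
  [/\ dom (X + B *+ 2 - T) = mid B D, dom (C *+ 2 + X - S) = mid C D,
      dom (mid C D + mid B D - X) = D *+ 2 &
      m = (Phi (S + T - A *+ 2)%R + Phi (X + B *+ 2 - T)%R +
           Phi (C *+ 2 + X - S)%R + Phi (mid C D + mid B D - X)%R)%N].

Lemma block_ruleC mid Phi A B C D m : block_rule mid Phi A B C D m -> block_rule mid Phi A C B D m.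
Proof.
rewrite /block_rule /= [mid A B + mid A C]addrC; set X := dom (_ - A *+ 2).
rewrite [mid B D + mid C D]addrC [X + C *+ 2]addrC [B *+ 2 + X]addrC.
by move=> [-> -> -> ->]; split=> //; congr (_ + _)%N; apply: addnAC.
Qed.

Definition good_mid (mid : 'rV[int]_r -> 'rV[int]_r -> 'rV[int]_r) : Prop :=
  forall A B, ispart (parts A) -> ispart (parts B) -> vstep A B -> ispart (parts (mid A B)).

(** Reduces a block to four row-wise identities. The shapes are the midpoints of the top, left,
    right and bottom edges ([t], [s], [rb], [bb]) and the centre [x]. *)
Lemma block_ruleI mid Phi A B C D (t s x rb bb : shape) p1 p2 p3 p4 :
  good_Phi Phi -> good_mid mid ->
  ispart (parts B) -> ispart (parts C) -> ispart (parts D) -> vstep B D -> vstep C D ->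
  ispart x -> supported r x ->
  (forall k, parts (mid A B) k = t k) -> (forall k, parts (mid A C) k = s k) ->
  (forall k, parts (mid B D) k = rb k) -> (forall k, parts (mid C D) k = bb k) ->
  sorts_to (fun k => s k + t k - parts A k *+ 2) x p1 ->
  sorts_to (fun k => x k + parts B k *+ 2 - t k) rb p2 ->
  sorts_to (fun k => parts C k *+ 2 + x k - s k) bb p3 ->
  sorts_to (fun k => bb k + rb k - x k) (fun k => parts D k *+ 2) p4 ->
  block_rule mid Phi A B C D (p1 + p2 + p3 + p4).
Proof.
move=> gP gm pB pC pD vBD vCD px sx et es er eb d1 d2 d3 d4; rewrite /block_rule /=.
have [e1 f1] : parts (dom (mid A C + mid A B - A *+ 2)) = x /\ Phi (mid A C + mid A B - A *+ 2) = p1.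
  by apply: (sorts_toP gP px sx _ d1) => k; rewrite !partsE es et.
set X := dom _ in e1 *.
have srb : supported r rb by move=> k lk; rewrite -er parts_ge.
have sbb : supported r bb by move=> k lk; rewrite -eb parts_ge.
have erb : parts (mid B D) = rb by apply: functional_extensionality.
have ebb : parts (mid C D) = bb by apply: functional_extensionality.
have prb : ispart rb by rewrite -erb; apply: gm.
have pbb : ispart bb by rewrite -ebb; apply: gm.
have [e2 f2] : parts (dom (X + B *+ 2 - mid A B)) = rb /\ Phi (X + B *+ 2 - mid A B) = p2.
  by apply: (sorts_toP gP prb srb _ d2) => k; rewrite !partsE et e1.
have [e3 f3] : parts (dom (C *+ 2 + X - mid A C)) = bb /\ Phi (C *+ 2 + X - mid A C) = p3.
  by apply: (sorts_toP gP pbb sbb _ d3) => k; rewrite !partsE es e1.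
have ed : parts (D *+ 2) = fun k => parts D k *+ 2.
  by apply: functional_extensionality => k; rewrite !partsE.
have [e4 f4] : parts (dom (mid C D + mid B D - X)) = parts (D *+ 2) /\
    Phi (mid C D + mid B D - X) = p4.
  apply: (sorts_toP gP (w := fun k => bb k + rb k - x k)).
  - exact: ispart2.
  - exact: parts_ge.
  - by move=> k; rewrite !partsE er eb e1.
  - by rewrite ed.
split; last by rewrite f1 f2 f3 f4.
- by apply: parts_inj; rewrite e2 erb.
- by apply: parts_inj; rewrite e3 ebb.
- by apply: parts_inj.
Qed.

Definition midF A B : 'rV[int]_r :=
  if add_box A B then A *+ 2 + const_mx 1
  else if add_box B A then B *+ 2 + const_mx 1
  else A *+ 2 + const_mx 1 - e_last r *+ 2.

Lemma parts_const1 k : parts (const_mx 1 : 'rV[int]_r) k = Posz (k < r)%N.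
Proof.
case: (ltnP k r) => lk; last by rewrite (parts_ge _ lk).
by rewrite -[k]/(nat_of_ord (Ordinal lk)) parts_ord mxE.
Qed.

Lemma midO_box A B a : parts B = box (parts A) a ->
  (forall k, parts (midO A B) k = parts A k *+ 2 + Posz (k == a)) /\
  (forall k, parts (midO B A) k = parts A k *+ 2 + Posz (k == a)).
Proof.
move=> e; have h : adjacent (parts A) (parts B) by left; exists a.
rewrite /midO (adjacent_neq h) (adjacent_neq (adjacentC h)) /=.
by split=> k; rewrite !partsE e /box; lia.
Qed.

Lemma midF_box A B a : parts B = box (parts A) a ->
  (forall k, parts (midF A B) k = parts A k *+ 2 + Posz (k < r)%N) /\
  (forall k, parts (midF B A) k = parts A k *+ 2 + Posz (k < r)%N).
Proof.
move=> e; have h : add_box A B by apply/add_boxP; exists a.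
have h2 : add_box B A = false.
  by apply/add_boxP => -[b]; rewrite e => /esym/box2_neq.
rewrite /midF h h2.
by split=> k; rewrite !partsE parts_const1.
Qed.

Hypothesis r0 : (0 < r)%N.

Lemma midO_stay A k : parts (midO A A) k = parts A k *+ 2 - Posz (k == r.-1).
Proof. by rewrite /midO eqxx /= !partsE parts_e_last //; lia. Qed.

Lemma midF_stay A k :
  parts (midF A A) k = parts A k *+ 2 + Posz (k < r)%N - Posz (k == r.-1) *+ 2.
Proof.
have h : add_box A A = false by apply/add_boxP => -[b] e; apply: (box_neq (esym e)).
by rewrite /midF h !partsE parts_const1 parts_e_last.
Qed.

Definition vec_of (f : shape) : 'rV[int]_r := \row_(j < r) f j.
Lemma parts_vec_of f : supported r f -> parts (vec_of f) = f.
Proof. by move=> sf; apply: partsP => // i; rewrite mxE. Qed.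

Lemma box_lt A B a : parts B = box (parts A) a -> (a < r)%N.
Proof.
move=> e; case: (ltnP a r) => // la.
by have := parts_ge B la; rewrite e /box (parts_ge A la); lia.
Qed.

Definition blocks A B C : Prop := exists D m,
  [/\ ispart (parts D), vstep B D, vstep C D,
      block_rule (@midO r) (@Phi_O r) A B C D m & block_rule midF (@Phi_F r) A B C D m].

Lemma blocksC A B C : blocks A B C -> blocks A C B.
Proof.
case=> D [m [h1 h2 h3 h4 h5]]; exists D, m.
by split; [exact: h1|exact: h3|exact: h2|exact: block_ruleC h4|exact: block_ruleC h5].
Qed.

Lemma good_midF : good_mid midF.
Proof.
move=> A B pA pB; case=> [[[a e]|[a e]]|[<- p]] k.
- have [h _] := midF_box e; rewrite !h; have := pA k; lia.
- have [_ h] := midF_box e; rewrite !h; have := pB k; lia.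
rewrite !midF_stay; have := pA k; have := p k; have := p k.+1.
by have := @parts_ge r A k.+1; lia.
Qed.

Lemma blocksI A B C D (xO xF tO sO rO bO tF sF rF bF : shape) p1 p2 p3 p4 q1 q2 q3 q4 :
  (p1 + p2 + p3 + p4 = q1 + q2 + q3 + q4)%N ->
  ispart (parts B) -> ispart (parts C) -> ispart (parts D) -> vstep B D -> vstep C D ->
  (forall k, parts (midO A B) k = tO k) -> (forall k, parts (midO A C) k = sO k) ->
  (forall k, parts (midO B D) k = rO k) -> (forall k, parts (midO C D) k = bO k) ->
  (forall k, parts (midF A B) k = tF k) -> (forall k, parts (midF A C) k = sF k) ->
  (forall k, parts (midF B D) k = rF k) -> (forall k, parts (midF C D) k = bF k) ->
  ispart xO -> supported r xO -> ispart xF -> supported r xF ->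
  [/\ sorts_to (fun k => sO k + tO k - parts A k *+ 2) xO p1,
      sorts_to (fun k => xO k + parts B k *+ 2 - tO k) rO p2,
      sorts_to (fun k => parts C k *+ 2 + xO k - sO k) bO p3 &
      sorts_to (fun k => bO k + rO k - xO k) (fun k => parts D k *+ 2) p4] ->
  [/\ sorts_to (fun k => sF k + tF k - parts A k *+ 2) xF q1,
      sorts_to (fun k => xF k + parts B k *+ 2 - tF k) rF q2,
      sorts_to (fun k => parts C k *+ 2 + xF k - sF k) bF q3 &
      sorts_to (fun k => bF k + rF k - xF k) (fun k => parts D k *+ 2) q4] ->
  blocks A B C.
Proof.
move=> epq pB pC pD vBD vCD etO esO erO ebO etF esF erF ebF pxO sxO pxF sxF
  [O1 O2 O3 O4] [F1 F2 F3 F4].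
exists D, (p1 + p2 + p3 + p4)%N; split=> //.
  exact: (block_ruleI good_Phi_O (@midO_part r r0) pB pC pD vBD vCD pxO sxO etO esO erO ebO).
rewrite epq.
exact: (block_ruleI good_Phi_F good_midF pB pC pD vBD vCD pxF sxF etF esF erF ebF).
Qed.

(** For [a = b] with [j] different from [a], the first embedding exchanges entries differing by 1
    twice, at the right and the bottom edge; the second exchanges entries differing by 2 once, at
    the last corner. *)
Lemma block_up A B C a b : ispart (parts A) -> ispart (parts B) -> ispart (parts C) ->
  parts B = box (parts A) a -> parts C = box (parts A) b -> blocks A B C.
Proof.
move=> pA pB pC eB eC.
have la := box_lt eB; have lb := box_lt eC.
have [tO _] := midO_box eB; have [sO _] := midO_box eC.
have [tF _] := midF_box eB; have [sF _] := midF_box eC.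
have sA k : (r <= k)%N -> parts A k = 0 := @parts_ge r A k.
have [eab|nab] := eqVneq a b.
  subst b; have pB' := pB; rewrite eB in pB'.
  have [j [lja hj pj]] := next_column pA pB'.
  have lj : (j < r)%N by lia.
  pose D := vec_of (box (box (parts A) a) j).
  have eD : parts D = box (box (parts A) a) j.
    by apply: parts_vec_of => k lk; rewrite /box sA //; lia.
  have pD : ispart (parts D) by rewrite eD.
  have eBD : parts D = box (parts B) j by rewrite eD eB.
  have eCD : parts D = box (parts C) j by rewrite eD eC.
  have [rO _] := midO_box eBD; have [bO _] := midO_box eCD.
  have [rF _] := midF_box eBD; have [bF _] := midF_box eCD.
  have vBD : vstep B D by left; left; exists j.
  have vCD : vstep C D by left; left; exists j.
  (* The two functions are the centres of the block for the two embeddings; the eight numbers are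
     the fillings of their four cells. *)
  apply: (@blocksI A B C D (fun k => parts A k *+ 2 + Posz (k == a) *+ 2)
    (fun k => parts A k *+ 2 + Posz (k < r)%N *+ 2) _ _ _ _ _ _ _ _ 0 0 0 0 0 0 0 0 erefl
    pB pC pD vBD vCD tO sO rO bO tF sF rF bF); rewrite ?eB ?eC ?eD.
  - by move=> k; have := pA k; have := pB' k; rewrite /box; lia.
  - by move=> k lk; rewrite sA //; lia.
  - by move=> k; have := pA k; lia.
  - by move=> k lk; rewrite sA //; lia.
  - split; first by apply: SortsId => k; lia.
    + apply: (SortsSwap (a := a) (j := j) (c := 1)) => //.
        by move=> k; rewrite /box; lia.
      case: hj => [->|hj]; [by left|right; split=> //]; have := @eq_index (parts A) j a; rewrite /box; lia.
    + apply: (SortsSwap (a := a) (j := j) (c := 1)) => //.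
        by move=> k; rewrite /box; lia.
      case: hj => [->|hj]; [by left|right; split=> //]; have := @eq_index (parts A) j a; rewrite /box; lia.
    + by apply: SortsId => k; rewrite /box; lia.
  - split; first by apply: SortsId => k; lia.
    + by apply: SortsId => k; rewrite /box; lia.
    + by apply: SortsId => k; rewrite /box; lia.
    + apply: (SortsSwap (a := a) (j := j) (c := 2)) => //.
        by move=> k; rewrite /box; lia.
      case: hj => [->|hj]; [by left|right; split=> //]; have := @eq_index (parts A) j a; rewrite /box; lia.
pose D := vec_of (box (box (parts A) a) b).
have eD : parts D = box (box (parts A) a) b.
  by apply: parts_vec_of => k lk; rewrite /box sA //; lia.
have eBD : parts D = box (parts B) b by rewrite eD eB.
have eCD : parts D = box (parts C) a by rewrite eD eC boxC.
have [rO _] := midO_box eBD; have [bO _] := midO_box eCD.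
have [rF _] := midF_box eBD; have [bF _] := midF_box eCD.
have vBD : vstep B D by left; left; exists b.
have vCD : vstep C D by left; left; exists a.
have pD : ispart (parts D).
  by rewrite eD; apply: union_part; rewrite -?eB -?eC //; apply/eqP.
apply: (@blocksI A B C D (fun k => parts A k *+ 2 + Posz (k == a) + Posz (k == b))
  (fun k => parts A k *+ 2 + Posz (k < r)%N *+ 2) _ _ _ _ _ _ _ _ 0 0 0 0 0 0 0 0 erefl
  pB pC pD vBD vCD tO sO rO bO tF sF rF bF).
- by move=> k; have := pA k; have := pD k; rewrite eD /box; lia.
- by move=> k lk; rewrite sA //; lia.
- by move=> k; have := pA k; lia.
- by move=> k lk; rewrite sA //; lia.
- by split; apply: SortsId => k; rewrite ?eB ?eC ?eD /box; lia.
- by split; apply: SortsId => k; rewrite ?eB ?eC ?eD /box; lia.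
Qed.

Lemma block_mixed A B C a b : ispart (parts A) -> ispart (parts B) -> ispart (parts C) ->
  parts B = box (parts A) a -> parts A = box (parts C) b -> blocks A B C.
Proof.
move=> pA pB pC eB eA.
have la := box_lt eB; have lb := box_lt eA.
have [tO _] := midO_box eB; have [_ sO] := midO_box eA.
have [tF _] := midF_box eB; have [_ sF] := midF_box eA.
have sC k : (r <= k)%N -> parts C k = 0 := @parts_ge r C k.
have [d [ed dE]] := slide_idx_comm (parts C) b a.
have ls : (slide_idx (parts C) b a < r)%N by rewrite /slide_idx; case: ifP.
pose D := vec_of (box (parts C) (slide_idx (parts C) b a)).
have eD : parts D = box (parts C) (slide_idx (parts C) b a).
  by apply: parts_vec_of => k lk; rewrite /box sC //; lia.
have eDB : parts B = box (parts D) d by rewrite eD -ed -eA -eB.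
have [_ rO] := midO_box eDB; have [bO _] := midO_box eD.
have [_ rF] := midF_box eDB; have [bF _] := midF_box eD.
have vBD : vstep B D by left; right; exists d.
have vCD : vstep C D by left; left; exists (slide_idx (parts C) b a).
have pD : ispart (parts D).
  by rewrite eD; apply: slide_idx_part; rewrite -?eA -?eB.
apply: (@blocksI A B C D (fun k => parts C k *+ 2 + Posz (k == a) + Posz (k == b))
  (fun k => parts C k *+ 2 + Posz (k < r)%N *+ 2) _ _ _ _ _ _ _ _ 0 0 0 0 0 0 0 0 erefl
  pB pC pD vBD vCD tO sO rO bO tF sF rF bF).
- by move=> k; have := pC k; have := pB k; rewrite eB eA /box; lia.
- by move=> k lk; rewrite sC //; lia.
- by move=> k; have := pC k; lia.
- by move=> k lk; rewrite sC //; lia.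
- rewrite eD eB eA {rO bO rF bF eDB vCD pD ed ls D eD vBD}; move: dE; rewrite /slide_idx.
  case: (boolP (_ && _)) => [/andP[/eqP ea /eqP eCa]|_]; last first.
    by rewrite eqxx => ->; split; apply: SortsId => k; rewrite /box; lia.
  rewrite (_ : (b == a) = false); last by lia.
  move=> ->; rewrite -ea in eCa *; split.
  + by apply: SortsId => k; rewrite /box; lia.
  + apply: (SortsSwap (a := a) (j := b) (c := 1)) => //.
      by move=> k; rewrite /box; lia.
    by right; split=> //; rewrite /box; lia.
  + apply: (SortsSwap (a := a) (j := b) (c := 1)) => //.
      by move=> k; rewrite /box; lia.
    by right; split=> //; rewrite /box; lia.
  + by apply: SortsId => k; rewrite /box; lia.
- rewrite eD eB eA {rO bO rF bF eDB vCD pD ed ls D eD vBD}; move: dE; rewrite /slide_idx.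
  case: (boolP (_ && _)) => [/andP[/eqP ea /eqP eCa]|_]; last first.
    by move=> _; split; apply: SortsId => k; rewrite /box; lia.
  move=> _; rewrite -ea in eCa *; split; try by apply: SortsId => k; rewrite /box; lia.
  apply: (SortsSwap (a := a) (j := b) (c := 2)) => //.
    by move=> k; rewrite /box; lia.
  by right; split=> //; rewrite /box; lia.
Qed.

Lemma block_down A B C a b : ispart (parts A) -> ispart (parts B) -> ispart (parts C) ->
  parts A = box (parts B) a -> parts A = box (parts C) b -> blocks A B C.
Proof.
move=> pA pB pC eA eA'.
have la := box_lt eA; have lb := box_lt eA'.
have [_ tO] := midO_box eA; have [_ sO] := midO_box eA'.
have [_ tF] := midF_box eA; have [_ sF] := midF_box eA'.
have sB k : (r <= k)%N -> parts B k = 0 := @parts_ge r B k.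
have lr : (r.-1 < r)%N by lia.
have [eab|nab] := eqVneq a b; last first.
  pose E := unbox (parts B) b.
  have eB : parts B = box E b by rewrite unboxK.
  have eC : parts C = box E a.
    apply: functional_extensionality => k.
    by have := congr1 (fun h => h k) eA; rewrite eA' /E /box /unbox; lia.
  have pE : ispart E.
    apply: (@inter_part E b a); rewrite -?eB -?eC -?eA //.
    by apply/eqP; rewrite eq_sym.
  pose D := vec_of E.
  have eD : parts D = E.
    apply: parts_vec_of => k lk; have := sB k lk; rewrite eB /box.
    by have := ispart_ge0 k pE; lia.
  rewrite -eD in eB eC pE.
  have sD k : (r <= k)%N -> parts D k = 0 := @parts_ge r D k.
  have [_ rO] := midO_box eB; have [_ bO] := midO_box eC.
  have [_ rF] := midF_box eB; have [_ bF] := midF_box eC.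
  have vBD : vstep B D by left; right; exists b.
  have vCD : vstep C D by left; right; exists a.
  apply: (@blocksI A B C D (fun k => parts D k *+ 2 + Posz (k == a) + Posz (k == b))
    (fun k => parts D k *+ 2 + Posz (k < r)%N *+ 2) _ _ _ _ _ _ _ _ 0 0 0 0 0 0 0 0 erefl
    pB pC pE vBD vCD tO sO rO bO tF sF rF bF).
  - by move=> k; have := pE k; have := pA k; rewrite eA eB /box; lia.
  - by move=> k lk; rewrite sD //; lia.
  - by move=> k; have := pE k; lia.
  - by move=> k lk; rewrite sD //; lia.
  - by split; apply: SortsId => k; rewrite ?eA ?eC ?eB /box; lia.
  - by split; apply: SortsId => k; rewrite ?eA ?eC ?eB /box; lia.
subst b; have eCB : C = B by apply: parts_inj; apply: (@box_injl _ _ a); rewrite -eA -eA'.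
subst C => {eA' lb pC}.
(* If row [a] of [B] is empty, then [D = A], and in both embeddings the second and third cells are
   filled with 1. The negative entry is in row [a] for the first embedding and in the last row for
   the second. *)
have [B0|Bn] := eqVneq (parts B a) 0.
  have [rO _] := midO_box eA; have [rF _] := midF_box eA.
  have vBA : vstep B A by left; left; exists a.
  apply: (@blocksI A B B A (fun k => parts B k *+ 2)
    (fun k => parts B k *+ 2 + Posz (k < r)%N *+ 2 - Posz (k == r.-1) *+ 2)
    _ _ _ _ _ _ _ _ 0 1 1 0 0 1 1 0 erefl
    pB pB pA vBA vBA tO sO rO rO tF sF rF rF).
  - by move=> k; have := pB k; lia.
  - by move=> k lk; rewrite sB //; lia.
  - have Bl : parts B r.-1 = 0.
      by have := ispart_le (i := a) (j := r.-1) pB; have := ispart_ge0 r.-1 pB; lia.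
    by move=> k; have := pB k; have := sB k.+1; have := @eq_index (parts B) k.+1 r.-1; lia.
  - by move=> k lk; rewrite sB //; lia.
  - split.
    + by apply: SortsId => k; rewrite ?eA /box; lia.
    + apply: (SortsNeg (a := a) (c := 2)) => //; rewrite ?B0; last by lia.
      by move=> k; lia.
    + apply: (SortsNeg (a := a) (c := 2)) => //; rewrite ?B0; last by lia.
      by move=> k; lia.
    + by apply: SortsId => k; rewrite ?eA /box; lia.
  have Bl : parts B r.-1 = 0.
    by have := ispart_le (i := a) (j := r.-1) pB; have := ispart_ge0 r.-1 pB; lia.
  split.
  - apply: (SortsSwap (a := r.-1) (j := a) (c := 2)) => //.
      by move=> k; rewrite ?eA /box; lia.
    have [->|nl] := eqVneq a r.-1; [by left|right; split=> //].
    by rewrite B0 Bl; lia.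
  - apply: (SortsNeg (a := r.-1) (c := 2)) => //; rewrite ?Bl; last by lia.
    by move=> k; lia.
  - apply: (SortsNeg (a := r.-1) (c := 2)) => //; rewrite ?Bl; last by lia.
    by move=> k; lia.
  - apply: (SortsSwap (a := r.-1) (j := a) (c := 2)) => //.
      by move=> k; rewrite ?eA /box; lia.
    have [->|nl] := eqVneq a r.-1; [by left|right; split=> //].
    by rewrite eA /box B0 Bl; lia.
have [|j [laj ej pj]] := last_equal (a := a) (@parts_ge r B) pB.
  by have := ispart_ge0 a pB; lia.
have lj : (j < r)%N by case: (ltnP j r) => // /sB; lia.
pose D := vec_of (unbox (parts B) j).
have eD : parts D = unbox (parts B) j.
  by apply: parts_vec_of => k lk; rewrite /unbox sB //; lia.
have eB : parts B = box (parts D) j by rewrite eD unboxK.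
have [_ rO] := midO_box eB; have [_ rF] := midF_box eB.
have vBD : vstep B D by left; right; exists j.
have pD : ispart (parts D) by rewrite eD.
apply: (@blocksI A B B D (fun k => parts B k *+ 2)
    (fun k => parts D k *+ 2 + Posz (k < r)%N *+ 2)
    _ _ _ _ _ _ _ _ 0 0 0 0 0 0 0 0 erefl
    pB pB pD vBD vBD tO sO rO rO tF sF rF rF).
- by move=> k; have := pB k; lia.
- by move=> k lk; rewrite sB //; lia.
- by move=> k; have := pD k; lia.
- by move=> k lk; rewrite eD /unbox sB //; lia.
- rewrite eD eA; split.
  + by apply: SortsId => k; rewrite /box; lia.
  + apply: (SortsSwap (a := j) (j := a) (c := 1)) => //.
      by move=> k; rewrite /unbox; lia.
    by have [->|nl] := eqVneq j a; [left|right; split=> //; rewrite /unbox; lia].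
  + apply: (SortsSwap (a := j) (j := a) (c := 1)) => //.
      by move=> k; rewrite /unbox; lia.
    by have [->|nl] := eqVneq j a; [left|right; split=> //; rewrite /unbox; lia].
  + by apply: SortsId => k; rewrite /unbox; lia.
- rewrite eD eA; split.
  + apply: (SortsSwap (a := j) (j := a) (c := 2)) => //.
      by move=> k; rewrite /unbox /box; lia.
    by have [->|nl] := eqVneq j a; [left|right; split=> //; rewrite /unbox; lia].
  + by apply: SortsId => k; rewrite /unbox; lia.
  + by apply: SortsId => k; rewrite /unbox; lia.
  + by apply: SortsId => k; rewrite /unbox; lia.
Qed.

Lemma block_stay_up A C b : ispart (parts A) -> ispart (parts C) ->
  (forall k, (k < r)%N -> 0 < parts A k) -> parts C = box (parts A) b -> blocks A A C.
Proof.
move=> pA pC p eC.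
have lb := box_lt eC.
have tO := midO_stay A; have tF := midF_stay A.
have [sO _] := midO_box eC; have [sF _] := midF_box eC.
have bO := midO_stay C; have bF := midF_stay C.
have sA k : (r <= k)%N -> parts A k = 0 := @parts_ge r A k.
have vAC : vstep A C by left; left; exists b.
have vCC : vstep C C by right; split=> // k lk; rewrite eC /box; have := p k lk; lia.
apply: (@blocksI A A C C (fun k => parts A k *+ 2 + Posz (k == b) - Posz (k == r.-1))
  (fun k => parts A k *+ 2 + Posz (k < r)%N *+ 2 - Posz (k == r.-1) *+ 2)
  _ _ _ _ _ _ _ _ 0 0 0 0 0 0 0 0 erefl
  pA pC pC vAC vCC tO sO sO bO tF sF sF bF).
- move=> k; have := pA k; have := pC k; have := p k.+1; have := p k; have := sA k.+1.
  by rewrite eC /box; lia.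
- by move=> k lk; rewrite sA //; lia.
- by move=> k; have := pA k; have := p k; have := p k.+1; have := sA k.+1; lia.
- by move=> k lk; rewrite sA //; lia.
- by split; apply: SortsId => k; rewrite ?eC /box; lia.
- by split; apply: SortsId => k; rewrite ?eC /box; lia.
Qed.

Lemma block_stay_down A C b : ispart (parts A) -> ispart (parts C) ->
  (forall k, (k < r)%N -> 0 < parts A k) -> parts A = box (parts C) b -> blocks A A C.
Proof.
move=> pA pC p eA.
have lb := box_lt eA.
have tO := midO_stay A; have tF := midF_stay A.
have [_ sO] := midO_box eA; have [_ sF] := midF_box eA.
have sC k : (r <= k)%N -> parts C k = 0 := @parts_ge r C k.
have vAC : vstep A C by left; right; exists b.
have vCA : vstep C A by left; left; exists b.
have pXF : ispart (fun k => parts C k *+ 2 + Posz (k < r)%N *+ 2 - Posz (k == r.-1) *+ 2).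
  by move=> k; have := pC k; have := sC k.+1; lia.
(* [C] may be repeated only if its last part is positive. Otherwise the box was removed from the
   last row, [D] is [A] again, and the third cell is filled with 1 in both embeddings. *)
have [C0|Cn] := eqVneq (parts C r.-1) 0.
  have eb : b = r.-1.
    by have := p r.-1; rewrite eA /box C0; lia.
  have [bO _] := midO_box eA; have [bF _] := midF_box eA.
  have vAA : vstep A A by right.
  apply: (@blocksI A A C A (fun k => parts C k *+ 2)
    (fun k => parts C k *+ 2 + Posz (k < r)%N *+ 2 - Posz (k == r.-1) *+ 2)
    _ _ _ _ _ _ _ _ 0 0 1 0 0 0 1 0 erefl
    pA pC pA vAA vCA tO sO tO bO tF sF tF bF) => //.
  - by move=> k; have := pC k; lia.
  - by move=> k lk; rewrite sC //; lia.
  - by move=> k lk; rewrite sC //; lia.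
  - split; try by apply: SortsId => k; rewrite ?eA ?eb /box; lia.
    apply: (SortsNeg (a := b) (c := 2)) => //; last by rewrite eb C0 eqxx; lia.
    by move=> k; rewrite ?eb; lia.
  - split; try by apply: SortsId => k; rewrite ?eA ?eb /box; lia.
    apply: (SortsNeg (a := b) (c := 2)) => //; last by rewrite eb C0; lia.
    by move=> k; rewrite ?eb; lia.
have pos k : (k < r)%N -> 0 < parts C k.
  move=> lk; have := ispart_le (i := k) (j := r.-1) pC; have := ispart_ge0 r.-1 pC; lia.
have vCC : vstep C C by right.
have bO := midO_stay C; have bF := midF_stay C.
apply: (@blocksI A A C C (fun k => parts C k *+ 2 + Posz (k == b) - Posz (k == r.-1))
  (fun k => parts C k *+ 2 + Posz (k < r)%N *+ 2 - Posz (k == r.-1) *+ 2)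
  _ _ _ _ _ _ _ _ 0 0 0 0 0 0 0 0 erefl
  pA pC pC vAC vCC tO sO sO bO tF sF sF bF) => //.
- move=> k; have := pA k; have := pC k; have := pos k.+1; have := pos k; have := sC k.+1.
  by rewrite eA /box; lia.
- by move=> k lk; rewrite sC //; lia.
- by move=> k lk; rewrite sC //; lia.
- by split; apply: SortsId => k; rewrite ?eA /box; lia.
- by split; apply: SortsId => k; rewrite ?eA /box; lia.
Qed.

Lemma block_stay A : ispart (parts A) -> (forall k, (k < r)%N -> 0 < parts A k) -> blocks A A A.
Proof.
move=> pA p.
have tO := midO_stay A; have tF := midF_stay A.
have sA k : (r <= k)%N -> parts A k = 0 := @parts_ge r A k.
have vAA : vstep A A by right.
apply: (@blocksI A A A A (fun k => parts A k *+ 2 - Posz (k == r.-1) *+ 2)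
  (fun k => parts A k *+ 2 + Posz (k < r)%N *+ 2 - Posz (k == r.-1) *+ 4)
  _ _ _ _ _ _ _ _ 0 0 0 0 0 0 0 0 erefl
  pA pA pA vAA vAA tO tO tO tO tF tF tF tF).
- by move=> k; have := pA k; have := p k; have := p k.+1; have := sA k.+1; lia.
- by move=> k lk; rewrite sA //; lia.
- by move=> k; have := pA k; have := p k; have := p k.+1; have := sA k.+1; lia.
- by move=> k lk; rewrite sA //; lia.
- by split; apply: SortsId => k; lia.
- by split; apply: SortsId => k; lia.
Qed.

Lemma block_exists A B C : ispart (parts A) -> ispart (parts B) -> ispart (parts C) ->
  vstep A B -> vstep A C -> blocks A B C.
Proof.
move=> pA pB pC [[[a eB]|[a eA]]|[eB p]] [[[b eC]|[b eA']]|[eC p']]; try subst B; try subst C.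
- exact: block_up eB eC.
- exact: block_mixed eB eA'.
- by apply: blocksC; apply: block_stay_up eB.
- by apply: blocksC; apply: block_mixed eC eA.
- exact: block_down eA eA'.
- by apply: blocksC; apply: block_stay_down eA.
- exact: block_stay_up eC.
- exact: block_stay_down eA'.
- exact: block_stay.
Qed.

End Block.

(** * Promotion of both embeddings *)

Section Virtual.
Variable r : nat.
Hypothesis r0 : (0 < r)%N.
Implicit Types (A B C D : 'rV[int]_r) (lam mu : nat -> 'rV[int]_r).

Definition mid_iota (mid : 'rV[int]_r -> 'rV[int]_r -> 'rV[int]_r) lam (c : nat) :=
  if odd c then mid (lam c./2) (lam c./2.+1) else lam c./2 *+ 2.

Lemma iota_VOE lam c : iota_VO lam c = mid_iota (@midO r) lam c.
Proof. by rewrite /iota_VO /mid_iota /midO; case: (odd c). Qed.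
Lemma iota_VFE lam c : iota_VF lam c = mid_iota (@midF r) lam c.
Proof. by rewrite /iota_VF /mid_iota /midF; case: (odd c). Qed.

Lemma mid_iota_even mid lam i : mid_iota mid lam i.*2 = lam i *+ 2.
Proof. by rewrite /mid_iota odd_double doubleK. Qed.
Lemma mid_iota_odd mid lam i : mid_iota mid lam i.*2.+1 = mid (lam i) (lam i.+1).
Proof. by rewrite /mid_iota /= odd_double /= uphalf_double. Qed.

Lemma prow_ext s mu mu' N c : (forall c, (c <= N)%N -> mu c = mu' c) -> (c <= N)%N ->
  prow s mu c = prow s mu' c.
Proof.
move=> e; elim: c => //= c IH lc; case: ifP => // _.
by rewrite IH ?e //; lia.
Qed.

Lemma prom_a_ext mu mu' N c : (0 < N)%N -> (forall c, (c <= N)%N -> mu c = mu' c) ->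
  (c <= N)%N -> prom_a mu c = prom_a mu' c.
Proof. by move=> N0 e lc; rewrite /prom_a (e 1%N) //; apply: (@prow_ext _ _ _ N). Qed.

Lemma prom_b_ext mu mu' N c : (0 < N)%N -> (forall c, (c <= N)%N -> mu c = mu' c) ->
  (c <= N)%N -> prom_b mu c = prom_b mu' c.
Proof.
move=> N0 e lc; apply: (@prow_ext _ _ _ N) => // d ld.
exact: (prom_a_ext N0 e).
Qed.

(** Sequences are functions on all of [nat], and a promoted embedding agrees with the embedding of
    the next tableau only up to index [n.*2]. *)
Lemma promotion_ext n mu mu' : (0 < n)%N -> (forall c, (c <= n.*2)%N -> mu c = mu' c) ->
  promotion n mu = promotion n mu'.
Proof.
move=> n0 e; apply: functional_extensionality => c; rewrite /promotion.
have N0 : (0 < n.*2)%N by lia.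
case: ifP => h; first by apply: (prom_b_ext N0 e); lia.
by rewrite (prom_a_ext N0 e).
Qed.

Lemma column_filling_ext Phi mu mu' N c : (0 < N)%N ->
  (forall c, (c <= N)%N -> mu c = mu' c) -> (c <= N)%N ->
  column_filling Phi mu c = column_filling Phi mu' c.
Proof.
move=> N0 e lc; rewrite /column_filling.
by rewrite !(prom_b_ext N0 e) ?(prom_a_ext N0 e) ?e //; lia.
Qed.

Lemma prom_aS mu c : (1 < c)%N -> prom_a mu c.+1 = dom (prom_a mu c + mu c.+1 - mu c).
Proof. by case: c => [|[|c]]. Qed.
Lemma prom_bS mu c : (1 < c)%N ->
  prom_b mu c.+1 = dom (prom_b mu c + prom_a mu c.+1 - prom_a mu c).
Proof. by case: c => [|[|c]]. Qed.

Lemma vstepC A B : vstep A B -> vstep B A.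
Proof. by case=> [h|[<- h]]; [left; apply: adjacentC|right]. Qed.

Lemma vstep0 A : vstep 0 A -> adjacent (parts (0 : 'rV[int]_r)) (parts A).
Proof. by case=> // -[_ p]; have := p 0%N r0; rewrite parts0. Qed.

Lemma midO_sym A B : adjacent (parts A) (parts B) -> midO A B = midO B A.
Proof.
case=> -[a e]; apply: parts_inj; apply: functional_extensionality => k;
  by have [h1 h2] := midO_box e; rewrite h1 h2.
Qed.
Lemma midF_sym A B : adjacent (parts A) (parts B) -> midF A B = midF B A.
Proof.
case=> -[a e]; apply: parts_inj; apply: functional_extensionality => k;
  by have [h1 h2] := midF_box e; rewrite h1 h2.
Qed.

Section Step.
Variables (n : nat) (lam : nat -> 'rV[int]_r).
Hypothesis n0 : (0 < n)%N.
Hypothesis vl : vacillating n lam.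

Definition halfv (x : 'rV[int]_r) : 'rV[int]_r := \row_j ((x 0%R j) %/ 2)%Z.
Lemma halfvK x : halfv (x *+ 2) = x.
Proof.
have half2 (z : int) : ((z + z) %/ 2)%Z = z by lia.
by apply/rowP => j; rewrite mulr2n !mxE; apply: half2.
Qed.

Lemma halfv0 : halfv 0 = 0.
Proof. by have := halfvK 0; rewrite mul0rn. Qed.

Local Notation muO := (mid_iota (@midO r) lam).
Local Notation muF := (mid_iota (@midF r) lam).
(** Halving gives the new tableau as a function instead of a chain of existential witnesses. That
    nothing is lost is part of [promotion_inv]. *)
Definition promoted k := halfv (prom_b muO k.*2).
Local Notation D := promoted.

Definition promotion_inv k := [/\ ispart (parts (D k)), vstep (lam k) (D k),
  prom_b muO k.*2 = D k *+ 2 /\ prom_b muF k.*2 = D k *+ 2,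
  prom_a muO k.*2 = midO (lam k) (D k) & prom_a muF k.*2 = midF (lam k) (D k)].

(** The cells of both rows in columns [k.*2.+1] and [k.*2.+2] form one block, with corners twice
    [lam k], [lam k.+1], [C] and [E]. *)
Lemma column_step mid Phi k C E m : (0 < k)%N ->
  prom_b (mid_iota mid lam) k.*2 = C *+ 2 ->
  prom_a (mid_iota mid lam) k.*2 = mid (lam k) C ->
  block_rule mid Phi (lam k) (lam k.+1) C E m ->
  [/\ prom_b (mid_iota mid lam) k.*2.+2 = E *+ 2,
      prom_a (mid_iota mid lam) k.*2.+2 = mid (lam k.+1) E,
      prom_b (mid_iota mid lam) k.*2.+1 = mid C E &
      (column_filling Phi (mid_iota mid lam) k.*2.+1 +
       column_filling Phi (mid_iota mid lam) k.*2.+2 = m)%N].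
Proof.
move=> k0 eb ea [h1 h2 h3 ->].
have a1 : prom_a (mid_iota mid lam) k.*2.+1 = dom (mid (lam k) C + mid (lam k) (lam k.+1) - lam k *+ 2).
  by rewrite prom_aS ?ea ?mid_iota_odd ?mid_iota_even //; lia.
have a2 : prom_a (mid_iota mid lam) k.*2.+2 = mid (lam k.+1) E.
  rewrite prom_aS ?a1; last by lia.
  by rewrite -doubleS mid_iota_odd mid_iota_even.
have b1 : prom_b (mid_iota mid lam) k.*2.+1 = mid C E.
  by rewrite prom_bS ?eb ?a1 ?ea //; lia.
split=> //.
  by rewrite prom_bS ?b1 ?a2 ?a1 //; lia.
rewrite /column_filling /= a2 b1 a1 eb ea -doubleS mid_iota_odd !mid_iota_even.
by rewrite -!addnA; congr addn; rewrite addnCA.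
Qed.

Lemma promotion_inv1 : promotion_inv 1.
Proof.
have [l0 ln pl st] := vl.
have v1 : vstep 0 (lam 1%N) by rewrite -l0; apply: st.
have e0 : D 1 = 0 by exact: halfv0.
rewrite /promotion_inv e0 mul0rn; split=> //.
- by rewrite parts_zero; apply: ispart_shape0.
- exact: vstepC.
- by rewrite -[prom_a _ _]/(mid_iota (@midO r) lam 1) (mid_iota_odd _ _ 0) l0 midO_sym //; apply: vstep0.
- by rewrite -[prom_a _ _]/(mid_iota (@midF r) lam 1) (mid_iota_odd _ _ 0) l0 midF_sym //; apply: vstep0.
Qed.

Lemma promotion_invS k : (0 < k < n)%N -> promotion_inv k ->
  [/\ promotion_inv k.+1, vstep (D k) (D k.+1),
    prom_b muO k.*2.+1 = midO (D k) (D k.+1) /\ prom_b muF k.*2.+1 = midF (D k) (D k.+1) &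
    (column_filling (@Phi_O r) muO k.*2.+1 + column_filling (@Phi_O r) muO k.*2.+2 =
     column_filling (@Phi_F r) muF k.*2.+1 + column_filling (@Phi_F r) muF k.*2.+2)%N].
Proof.
move=> lk [pD vD [bO bF] aO aF]; have [l0 ln pl st] := vl.
have [|||E [m [pE vBE vCE blO blF]]] :=
  @block_exists r r0 (lam k) (lam k.+1) (D k) _ _ pD _ vD.
- by apply: pl; lia.
- by apply: pl; lia.
- by apply: st; lia.
have [|bO2 aO2 bO1 fO] := column_step _ bO aO blO; first by lia.
have [|bF2 aF2 bF1 fF] := column_step _ bF aF blF; first by lia.
have eE : D k.+1 = E by rewrite /promoted doubleS bO2 halfvK.
by rewrite /promotion_inv !eE doubleS; split=> //; rewrite fO fF.
Qed.

Lemma promotion_invP k : (0 < k <= n)%N -> promotion_inv k.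
Proof.
elim: k => [//|k IH] lk; have [->|nk] := eqVneq k 0%N; first exact: promotion_inv1.
by have [] := @promotion_invS k ltac:(lia) (IH ltac:(lia)).
Qed.

Definition lam_next c := if (c < n)%N then D c.+1 else 0.

Lemma vacillating_next : vacillating n lam_next.
Proof.
have [l0 ln pl st] := vl; split.
- by rewrite /lam_next n0; apply: halfv0.
- by rewrite /lam_next ltnn.
- move=> i li; rewrite /lam_next; case: ifP => h; last by rewrite parts_zero; apply: ispart_shape0.
  by have [] := @promotion_invP i.+1 ltac:(lia).
- move=> i li; rewrite /lam_next li; case: ifP => h.
    by have [] := @promotion_invS i.+1 ltac:(lia) (@promotion_invP i.+1 ltac:(lia)).
  have ei : i.+1 = n by lia.
  have [_ v _ _ _] := @promotion_invP n ltac:(lia).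
  by rewrite ei; apply: vstepC; rewrite -ln.
Qed.

Lemma promotion_next c : (c <= n.*2)%N ->
  promotion n muO c = mid_iota (@midO r) lam_next c /\
  promotion n muF c = mid_iota (@midF r) lam_next c.
Proof.
have [l0 ln pl st] := vl.
move=> lc; rewrite /promotion; have [i [e|e]] := half_cases c; subst c.
  rewrite !mid_iota_even /lam_next; case: ifP => h.
    rewrite ifT; last by lia.
    by have [_ _ [h1 h2] _ _] := @promotion_invP i.+1 ltac:(lia); rewrite -doubleS.
  rewrite ifF ?ifF; try lia.
  by rewrite mul0rn.
rewrite !mid_iota_odd /lam_next; case: ifP => h.
  rewrite !ifT; try lia.
  by have [_ _ [h1 h2] _] := @promotion_invS i.+1 ltac:(lia) (@promotion_invP i.+1 ltac:(lia)); rewrite -doubleS.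
(* The entry at [n.*2.-1] comes from the first row, where [lam n = 0] and [D n] stand in the
   opposite order; symmetry of the midpoint for adjacent shapes corrects this. *)
have ei : i.+1 = n by lia.
have -> : (i < n)%N by lia.
have -> : (i.+1 < n)%N = false by lia.
have -> : i.*2.+1 == n.*2.-1 by lia.
have [pD v _ h1 h2] := @promotion_invP n ltac:(lia).
rewrite ei h1 h2 ln; rewrite ln in v.
by have nD := vstep0 v; split; [apply: midO_sym|apply: midF_sym].
Qed.

Lemma filling_eq k : (1 < k <= n)%N ->
  (column_filling (@Phi_O r) muO k.*2.-1 + column_filling (@Phi_O r) muO k.*2 =
   column_filling (@Phi_F r) muF k.*2.-1 + column_filling (@Phi_F r) muF k.*2)%N.
Proof.
case: k => [//|k] lk.
by have [] := @promotion_invS k ltac:(lia) (@promotion_invP k ltac:(lia)).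
Qed.

End Step.

Lemma iter_promotion_next n lam s : (0 < n)%N -> vacillating n lam -> exists lam', vacillating n lam' /\
  forall c, (c <= n.*2)%N ->
    iter s (promotion n) (iota_VO lam) c = mid_iota (@midO r) lam' c /\
    iter s (promotion n) (iota_VF lam) c = mid_iota (@midF r) lam' c.
Proof.
move=> n0 vl; elim: s => [|s [lam' [vl' IH]]].
  by exists lam; split=> // c _; rewrite /= iota_VOE iota_VFE.
exists (lam_next n lam'); split; first exact: vacillating_next.
move=> c lc; have [<- <-] := promotion_next n0 vl' lc.
rewrite !iterS; split; congr (_ c); apply: promotion_ext => // d ld.
  by have [] := IH d ld.
by have [] := IH d ld.
Qed.

Lemma M_VO_M_VF n (V : n.+1.-tuple 'rV[int]_r) : vacillating_tableau V -> M_VO V = M_VF V.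
Proof.
move=> /vacillatingP vl; apply/matrixP => i j; rewrite /M_VO /M_VF !mxE.
have li := ltn_ord i; have lj := ltn_ord j.
case: ifP => // /eqP nij; cbv zeta.
have nn : (i : nat) <> j by move=> e; apply: nij; apply: val_inj.
have n0 : (0 < n)%N by lia.
have [lam' [vl' e]] := iter_promotion_next i n0 vl.
pose m := ((j + n - i) %% n)%N.
have em : m = if (i < j)%N then (j - i)%N else (j + n - i)%N.
  rewrite /m; case: ifP => lij; last by rewrite modn_small //; lia.
  by rewrite (_ : j + n - i = j - i + n)%N ?modnDr ?modn_small //; lia.
have hm : (0 < m < n)%N by move: em; case: ifP => lij ->; lia.
rewrite -/m; clearbody m.
have N0 : (0 < n.*2)%N by lia.
have eO c : (c <= n.*2)%N -> iter i (promotion n) (iota_VO (nth 0 V)) c = mid_iota (@midO r) lam' c.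
  by move=> /e[].
have eF c : (c <= n.*2)%N -> iter i (promotion n) (iota_VF (nth 0 V)) c = mid_iota (@midF r) lam' c.
  by move=> /e[].
rewrite !(column_filling_ext _ N0 eO) ?(column_filling_ext _ N0 eF); try lia.
by congr Posz; apply: (@filling_eq n lam' n0 vl' m.+1); lia.
Qed.

End Virtual.

Theorem theorem4p11 (r n : nat) (hr : (0 < r)%N) (hn : (0 < n)%N)
    (V : n.+1.-tuple 'rV[int]_r) (hV : vacillating_tableau V) :
  G_V V = M_VO V /\ M_VO V = M_VF V.
Proof. by split; [apply: G_V_M_VO|apply: M_VO_M_VF]. Qed.
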